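(* Let $E$ be a Hermite–Biehler entire function with no real zeros, and let $f \in \mathcal{H}^{\infty}(E)$ be a real entire function. Suppose that $f(\xi) = \lvert E(\xi)\rvert \, \lVert f/E\rVert_{\infty}$ for some $\xi \in \mathbb{R}$. Let $\alpha \in \mathbb{R}$ be such that $E(\xi) = e^{-i\alpha}\lvert E(\xi)\rvert$, and let $b_l$ and $b_r$ denote the simple zeros of $B_\alpha$ to the left and to the right of $\xi$, respectively. Then $$f(x) \geq \lVert f/E\rVert_{\infty}\, A_\alpha(x), \qquad b_l \leq x \leq b_r.$$
   Context: An entire function $E$ is Hermite–Biehler ($E \in HB$) if $\lvert E(\overline{z})\rvert < \lvert E(z)\rvert$ for all $z$ in the upper half-plane $\mathbb{C}_+$. For an entire function $g$, $g^{\#}(z) = \overline{g(\overline{z})}$; $g$ is real entire if it is real on the real axis. $\mathcal{H}^{\infty}(E)$ is the set of entire functions $f$ such that $f/E$ and $f^{\#}/E$ are bounded analytic functions on $\mathbb{C}_+$, with $\lVert f/E\rVert_\infty = \sup_{x\in\mathbb{R}} \lvert f(x)/E(x)\rvert$. For $\alpha\in\mathbb{R}$, write $E_\alpha = e^{i\alpha}E = A_\alpha + iB_\alpha$, where $A_\alpha = (E_\alpha + E_\alpha^{\#})/2$ and $B_\alpha = (E_\alpha - E_\alpha^{\#})/(2i)$ are real entire functions. *)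

(* Defs.v *)
From Stdlib Require Import Reals.
From Coquelicot Require Import Coquelicot.
Open Scope R_scope.

Definition C_differentiable (g : C -> C) (z : C) : Prop :=
  exists l : C, @is_derive C_AbsRing C_NormedModule g z l.

Definition entire (g : C -> C) : Prop := forall z : C, C_differentiable g z.

Definition in_Cplus (z : C) : Prop := Im z > 0.

Definition sharp (g : C -> C) : C -> C := fun z => Cconj (g (Cconj z)).

Definition real_entire (g : C -> C) : Prop :=
  entire g /\ forall x : R, Im (g (RtoC x)) = 0.

Definition HB (E : C -> C) : Prop :=
  entire E /\ forall z : C, in_Cplus z -> Cmod (E (Cconj z)) < Cmod (E z).

Definition bounded_analytic_Cplus (h : C -> C) : Prop :=
  (forall z, in_Cplus z -> C_differentiable h z) /\
  exists M : R, forall z, in_Cplus z -> Cmod (h z) <= M.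

Definition Hinf (E f : C -> C) : Prop :=
  entire f /\
  bounded_analytic_Cplus (fun z => (f z / E z)%C) /\
  bounded_analytic_Cplus (fun z => (sharp f z / E z)%C).

Definition supnorm (f E : C -> C) : R :=
  real (Lub_Rbar (fun y : R => exists x : R, y = Cmod ((f (RtoC x) / E (RtoC x))%C))).

Definition cis (a : R) : C := (cos a, sin a).

Definition E_rot (alpha : R) (E : C -> C) : C -> C := fun z => (cis alpha * E z)%C.
Definition A_fun (alpha : R) (E : C -> C) : C -> C :=
  fun z => ((E_rot alpha E z + sharp (E_rot alpha E) z) / 2)%C.
Definition B_fun (alpha : R) (E : C -> C) : C -> C :=
  fun z => ((E_rot alpha E z - sharp (E_rot alpha E) z) / (2 * Ci))%C.

(* Main.v *)
(** Write [H = e^(i alpha) E = A + i B] on the real line and [M = ||f/E||].  By the maximum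
    principle in the half-plane, [|f| <= M |H|] there, so for [M' > M] the function
    [G = M' H - f] has no zero in the closed upper half-plane and [G^#/G], being bounded and
    unimodular on the real line, is bounded by [1].  Hence [|G|^2] grows in the direction [i]
    at real points at least as fast as [|G^#|^2], which says that the Wronskian of [M' A - f]
    and [B] has a sign; letting [M'] tend to [M], [(M A - f) / B] is nondecreasing between
    zeros of [B].  At [xi], [M A - f] vanishes to second order because [f <= M |H|] touches
    there, while [B' < 0] by Hopf's lemma for [H^#/H].  So the quotient tends to [0] at [xi],
    which determines the sign of [M A - f] on both sides. *)

Require Import Defs.
From Stdlib Require Import Reals Lra Psatz Classical ClassicalEpsilon.
From Coquelicot Require Import Coquelicot.
Open Scope R_scope.

(** The detour through [M' > M] is forced: [M H - f] vanishes at [xi], so for [M' = M] the quotient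
    [G^#/G] would have no controlled denominator. The gap gives [|G| >= (M' - M) |H|], hence the
    absence of zeros together with an a priori bound on [G^#/G], without which the maximum principle
    is false in an unbounded region. The limit is harmless because [f] is real on the line: there
    the imaginary part of [G] is [M' B], and the factor [M'] cancels from the Wronskian inequality.
    Only weak inequalities survive such a limit, so the strict sign of [B'] at [xi] has to come from
    the strict inequality in the definition of a Hermite-Biehler function. The function theory
    itself is built on rectangles: one bisection principle yields both Green's identity for closed
    forms and the existence of maxima, and circle means are integrals over a rectangle in polar
    coordinates. *)

(** * Bisection of intervals and rectangles *)

Lemma nested_intervals (a b : nat -> R) :
  (forall n, a n <= a (S n)) -> (forall n, b (S n) <= b n) ->
  (forall n, a n <= b n) -> exists x, forall n, a n <= x <= b n.
Proof.
  intros Ha Hb Hab.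
  assert (Ha' : forall n k, a n <= a (n + k)%nat).
  { intros n k; induction k as [|k IH].
    - rewrite Nat.add_0_r; lra.
    - rewrite Nat.add_succ_r. specialize (Ha (n + k)%nat); lra. }
  assert (Hb' : forall n k, b (n + k)%nat <= b n).
  { intros n k; induction k as [|k IH].
    - rewrite Nat.add_0_r; lra.
    - rewrite Nat.add_succ_r. specialize (Hb (n + k)%nat); lra. }
  assert (H : forall n m, a n <= b m).
  { intros n m.
    specialize (Ha' n m); specialize (Hb' m n); specialize (Hab (n + m)%nat).
    rewrite (Nat.add_comm m n) in Hb'; lra. }
  destruct (completeness (fun r => exists n, r = a n)) as [x [Hx1 Hx2]].
  - exists (b 0%nat). intros r [n ->]; apply H.
  - exists (a 0%nat), 0%nat; reflexivity.
  - exists x; intros n; split.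
    + apply Hx1; exists n; reflexivity.
    + apply Hx2; intros r [m ->]; apply H.
Qed.

Lemma half_pow_small (l eps : R) : 0 < eps -> exists n, l * (1 / 2) ^ n < eps.
Proof.
  intros He.
  destruct (pow_lt_1_zero (1 / 2)) with (y := eps / (Rabs l + 1)) as [n Hn].
  - rewrite Rabs_pos_eq; lra.
  - apply Rdiv_lt_0_compat; [lra | pose proof (Rabs_pos l); lra].
  - exists n. specialize (Hn n (Nat.le_refl n)).
    pose proof (Rabs_pos l) as Hl.
    assert (Hp : 0 < (1 / 2) ^ n) by (apply pow_lt; lra).
    rewrite Rabs_pos_eq in Hn by lra.
    apply Rlt_div_r in Hn; [|lra].
    pose proof (Rle_abs l). nra.
Qed.

(** A failure on the whole rectangle would pass to one of its quarters, and so on forever; the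
    nested failing rectangles shrink to a point, where the local hypothesis is contradicted.
    Goursat's estimate and the existence of maxima are both instances. *)
Lemma cousin_rectangle (P : R -> R -> R -> R -> Prop) (a b c d : R) :
  a <= b -> c <= d ->
  (forall a1 b1 c1 d1, a <= a1 <= b1 -> b1 <= b -> c <= c1 <= d1 -> d1 <= d ->
     P a1 ((a1 + b1) / 2) c1 ((c1 + d1) / 2) ->
     P ((a1 + b1) / 2) b1 c1 ((c1 + d1) / 2) ->
     P a1 ((a1 + b1) / 2) ((c1 + d1) / 2) d1 ->
     P ((a1 + b1) / 2) b1 ((c1 + d1) / 2) d1 -> P a1 b1 c1 d1) ->
  (forall x y, a <= x <= b -> c <= y <= d -> exists delta, 0 < delta /\
     forall a1 b1 c1 d1, a <= a1 <= x -> x <= b1 <= b ->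
       c <= c1 <= y -> y <= d1 <= d ->
       b1 - a1 < delta -> d1 - c1 < delta -> P a1 b1 c1 d1) ->
  P a b c d.
Proof.
  intros Hab Hcd Hsplit Hloc. apply NNPP; intros HP.
  set (bad := fun r : (R * R) * (R * R) =>
    let '((a1, b1), (c1, d1)) := r in
    a <= a1 <= b1 /\ b1 <= b /\ c <= c1 <= d1 /\ d1 <= d /\ ~ P a1 b1 c1 d1).
  set (sub := fun r s : (R * R) * (R * R) =>
    let '((a1, b1), (c1, d1)) := r in let '((a2, b2), (c2, d2)) := s in
    (a1 <= a2 /\ b2 <= b1 /\ b2 - a2 = (b1 - a1) / 2) /\
    (c1 <= c2 /\ d2 <= d1 /\ d2 - c2 = (d1 - c1) / 2)).
  (* With [bad r] as a premise inside the existential, every rectangle has a successor, so choice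
     yields a total map to iterate. *)
  assert (Hnext : forall r, exists s, bad r -> bad s /\ sub r s).
  { intros [[a1 b1] [c1 d1]].
    destruct (classic (bad ((a1, b1), (c1, d1)))) as [Hb | Hb];
      [|exists ((a1, b1), (c1, d1)); tauto].
    destruct Hb as (H1 & H2 & H3 & H4 & H5).
    apply NNPP; intros Hno. apply H5; apply Hsplit; try assumption;
      apply NNPP; intros H6; apply Hno.
    - exists ((a1, (a1 + b1) / 2), (c1, (c1 + d1) / 2)); intros _; simpl.
      repeat split; try assumption; lra.
    - exists (((a1 + b1) / 2, b1), (c1, (c1 + d1) / 2)); intros _; simpl.
      repeat split; try assumption; lra.
    - exists ((a1, (a1 + b1) / 2), ((c1 + d1) / 2, d1)); intros _; simpl.
      repeat split; try assumption; lra.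
    - exists (((a1 + b1) / 2, b1), ((c1 + d1) / 2, d1)); intros _; simpl.
      repeat split; try assumption; lra. }
  set (next := fun r => proj1_sig (constructive_indefinite_description _ (Hnext r))).
  assert (Hn : forall r, bad r -> bad (next r) /\ sub r (next r)).
  { intros r; unfold next.
    destruct (constructive_indefinite_description _ (Hnext r)); assumption. }
  set (u := fun n => Nat.iter n next ((a, b), (c, d))).
  assert (Hu : forall n, bad (u n)).
  { induction n as [|n IH].
    - simpl; repeat split; try assumption; lra.
    - apply (Hn (u n) IH). }
  assert (Hs : forall n, sub (u n) (u (S n))) by (intros n; apply (Hn (u n) (Hu n))).
  destruct (nested_intervals (fun n => fst (fst (u n))) (fun n => snd (fst (u n))))
    as [x Hx].
  { intros n; specialize (Hs n); destruct (u n) as [[? ?] [? ?]], (u (S n)) as [[? ?] [? ?]];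
      simpl in *; tauto. }
  { intros n; specialize (Hs n); destruct (u n) as [[? ?] [? ?]], (u (S n)) as [[? ?] [? ?]];
      simpl in *; tauto. }
  { intros n; specialize (Hu n); destruct (u n) as [[? ?] [? ?]]; simpl in *; tauto. }
  destruct (nested_intervals (fun n => fst (snd (u n))) (fun n => snd (snd (u n))))
    as [y Hy].
  { intros n; specialize (Hs n); destruct (u n) as [[? ?] [? ?]], (u (S n)) as [[? ?] [? ?]];
      simpl in *; tauto. }
  { intros n; specialize (Hs n); destruct (u n) as [[? ?] [? ?]], (u (S n)) as [[? ?] [? ?]];
      simpl in *; tauto. }
  { intros n; specialize (Hu n); destruct (u n) as [[? ?] [? ?]]; simpl in *; tauto. }
  assert (Hsize : forall n, snd (fst (u n)) - fst (fst (u n)) = (b - a) * (1 / 2) ^ n /\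
                            snd (snd (u n)) - fst (snd (u n)) = (d - c) * (1 / 2) ^ n).
  { induction n as [|n IH].
    - simpl; lra.
    - specialize (Hs n).
      destruct (u n) as [[? ?] [? ?]], (u (S n)) as [[? ?] [? ?]]; simpl in *.
      lra. }
  destruct (Hloc x y) as [delta [Hd H]].
  { specialize (Hx 0%nat); simpl in Hx; lra. }
  { specialize (Hy 0%nat); simpl in Hy; lra. }
  destruct (half_pow_small ((b - a) + (d - c)) delta Hd) as [n Hsm].
  specialize (Hu n); specialize (Hx n); specialize (Hy n); specialize (Hsize n).
  assert (Hp : 0 < (1 / 2) ^ n) by (apply pow_lt; lra).
  destruct (u n) as [[a1 b1] [c1 d1]]; simpl in Hu, Hx, Hy, Hsize.
  destruct Hu as (H1 & H2 & H3 & H4 & H5).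
  apply H5, H; try lra; nra.
Qed.

(** * Closed forms and Green's identity on rectangles *)

Lemma differentiable_slice_l (f : R -> R -> R) (x y p q : R) :
  differentiable_pt_lim f x y p q -> continuous (fun t => f t y) x.
Proof.
  intros H. apply continuity_pt_filterlim, derivable_continuous_pt.
  exists (p * 1 + q * 0).
  apply (derivable_pt_lim_comp_2d f (fun t => t) (fun _ => y)); auto.
  - apply derivable_pt_lim_id.
  - apply derivable_pt_lim_const.
Qed.

Lemma differentiable_slice_r (f : R -> R -> R) (x y p q : R) :
  differentiable_pt_lim f x y p q -> continuous (fun t => f x t) y.
Proof.
  intros H. apply continuity_pt_filterlim, derivable_continuous_pt.
  exists (p * 0 + q * 1).
  apply (derivable_pt_lim_comp_2d f (fun _ => x) (fun t => t)); auto.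
  - apply derivable_pt_lim_const.
  - apply derivable_pt_lim_id.
Qed.

(** Closedness of the form [P dx + Q dy] at a point: the shared [q] is the equation between the
    [y]-derivative of [P] and the [x]-derivative of [Q]. *)
Definition closed_at (P Q : R -> R -> R) (x y : R) : Prop :=
  exists p q r, differentiable_pt_lim P x y p q /\ differentiable_pt_lim Q x y q r.

Lemma RInt_chasles_R (f : R -> R) (a b c : R) :
  ex_RInt f a b -> ex_RInt f b c -> RInt f a c = RInt f a b + RInt f b c.
Proof. intros H1 H2; symmetry; apply (RInt_Chasles f a b c H1 H2). Qed.

(** Serves to compare opposite sides of a small rectangle, with [k] the increment predicted by the
    differential. *)
Lemma RInt_diff_bound (f g : R -> R) (a b k M : R) :
  a <= b -> ex_RInt f a b -> ex_RInt g a b ->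
  (forall t, a <= t <= b -> Rabs (f t - g t - k) <= M) ->
  Rabs (RInt f a b - RInt g a b - (b - a) * k) <= (b - a) * M.
Proof.
  intros Hab Hf Hg H.
  assert (Hc : ex_RInt (fun _ : R => k) a b) by apply ex_RInt_const.
  assert (Hfg : ex_RInt (fun t => minus (f t) (g t)) a b)
    by apply (ex_RInt_minus f g a b Hf Hg).
  replace (RInt f a b - RInt g a b - (b - a) * k)
    with (RInt (fun t => minus (minus (f t) (g t)) k) a b).
  - apply abs_RInt_le_const; auto.
    apply (ex_RInt_minus (fun t => minus (f t) (g t)) (fun _ => k) a b Hfg Hc).
  - assert (E1 := @RInt_minus R_CompleteNormedModule f g a b Hf Hg).
    assert (E2 := @RInt_minus R_CompleteNormedModule (fun t => minus (f t) (g t))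
      (fun _ => k) a b Hfg Hc).
    assert (E3 := @RInt_const R_CompleteNormedModule a b k).
    etransitivity; [exact E2|]. exact (f_equal2 minus E1 E3).
Qed.

(* Goursat's bisection argument: no continuity of the partial derivatives is needed. *)
Lemma green_rectangle (P Q : R -> R -> R) (a b c d : R) :
  a <= b -> c <= d ->
  (forall x y, a <= x <= b -> c <= y <= d -> closed_at P Q x y) ->
  RInt (fun x => P x c) a b + RInt (fun y => Q b y) c d =
  RInt (fun x => P x d) a b + RInt (fun y => Q a y) c d.
Proof.
  intros Hab Hcd HPQ.
  assert (HP : forall y a1 b1, c <= y <= d -> a <= a1 <= b1 -> b1 <= b ->
                 ex_RInt (fun x => P x y) a1 b1).
  { intros y a1 b1 Hy Ha Hb. apply (@ex_RInt_continuous R_CompleteNormedModule).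
    intros z; rewrite Rmin_left, Rmax_right by lra; intros Hz.
    destruct (HPQ z y) as (p & q & r & H1 & H2); try lra.
    apply (differentiable_slice_l P z y p q H1). }
  assert (HQ : forall x c1 d1, a <= x <= b -> c <= c1 <= d1 -> d1 <= d ->
                 ex_RInt (fun y => Q x y) c1 d1).
  { intros x c1 d1 Hx Hc Hd. apply (@ex_RInt_continuous R_CompleteNormedModule).
    intros z; rewrite Rmin_left, Rmax_right by lra; intros Hz.
    destruct (HPQ x z) as (p & q & r & H1 & H2); try lra.
    apply (differentiable_slice_r Q x z q r H2). }
  set (J := fun a1 b1 c1 d1 =>
    (RInt (fun x => P x c1) a1 b1 - RInt (fun x => P x d1) a1 b1) +
    (RInt (fun y => Q b1 y) c1 d1 - RInt (fun y => Q a1 y) c1 d1)).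
  enough (H : forall eps, 0 < eps -> Rabs (J a b c d) <= eps).
  { assert (J a b c d = 0).
    { apply NNPP; intros H0. apply Rabs_pos_lt in H0.
      specialize (H (Rabs (J a b c d) / 2)). lra. }
    unfold J in *; lra. }
  intros eps0 Heps0.
  set (s := (b - a) + (d - c)).
  (* The error allowed on a rectangle is [eps] times the square of its half-perimeter, a quantity
     that is exactly additive under quartering. The [+ 1] keeps the quotient meaningful when the
     rectangle is a point. *)
  set (eps := eps0 / (s * s + 1)).
  assert (Heps : 0 < eps).
  { unfold eps; apply Rdiv_lt_0_compat; nra. }
  apply Rle_trans with (eps * (s * s)).
  2: { unfold eps. assert (0 <= s * s) by nra.
       replace eps0 with (eps0 / (s * s + 1) * (s * s + 1)) at 2 by (field; lra).
       assert (0 < eps0 / (s * s + 1)) by (apply Rdiv_lt_0_compat; lra). nra. }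
  unfold s.
  apply (cousin_rectangle (fun a1 b1 c1 d1 => Rabs (J a1 b1 c1 d1) <=
    eps * (((b1 - a1) + (d1 - c1)) * ((b1 - a1) + (d1 - c1))))); auto.
  - intros a1 b1 c1 d1 Ha Hb Hc Hd.
    set (m := (a1 + b1) / 2). set (n := (c1 + d1) / 2). intros H1 H2 H3 H4.
    assert (Hm : m - a1 = (b1 - a1) / 2 /\ b1 - m = (b1 - a1) / 2) by (unfold m; lra).
    assert (Hn : n - c1 = (d1 - c1) / 2 /\ d1 - n = (d1 - c1) / 2) by (unfold n; lra).
    destruct Hm as [Hm1 Hm2], Hn as [Hn1 Hn2].
    rewrite ?Hm1, ?Hn1 in H1. rewrite ?Hm2, ?Hn1 in H2.
    rewrite ?Hm1, ?Hn2 in H3. rewrite ?Hm2, ?Hn2 in H4.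
    assert (E : J a1 b1 c1 d1 = J a1 m c1 n + J m b1 c1 n + J a1 m n d1 + J m b1 n d1).
    { unfold J.
      rewrite (RInt_chasles_R (fun x => P x c1) a1 m b1) by (apply HP; lra).
      rewrite (RInt_chasles_R (fun x => P x d1) a1 m b1) by (apply HP; lra).
      rewrite (RInt_chasles_R (fun y => Q a1 y) c1 n d1) by (apply HQ; lra).
      rewrite (RInt_chasles_R (fun y => Q b1 y) c1 n d1) by (apply HQ; lra).
      lra. }
    rewrite E.
    apply Rle_trans with (Rabs (J a1 m c1 n) + Rabs (J m b1 c1 n) + Rabs (J a1 m n d1) +
      Rabs (J m b1 n d1)).
    { pose proof (Rabs_triang (J a1 m c1 n) (J m b1 c1 n)).
      pose proof (Rabs_triang (J a1 m c1 n + J m b1 c1 n) (J a1 m n d1)).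
      pose proof (Rabs_triang (J a1 m c1 n + J m b1 c1 n + J a1 m n d1) (J m b1 n d1)).
      lra. }
    lra.
  - intros x y Hx Hy. destruct (HPQ x y Hx Hy) as (p & q & r & H1 & H2).
    assert (He4 : 0 < eps / 4) by lra.
    destruct (H1 (mkposreal _ He4)) as [d1 Hd1]. destruct (H2 (mkposreal _ He4)) as [d2 Hd2].
    simpl in Hd1, Hd2.
    exists (Rmin d1 d2). split; [apply Rmin_pos; apply cond_pos|].
    intros a1 b1 c1 e1 Ha Hb Hc He Hs1 Hs2.
    pose proof (Rmin_l d1 d2). pose proof (Rmin_r d1 d2).
    set (t := (b1 - a1) + (e1 - c1)).
    assert (KP : forall x' y', a1 <= x' <= b1 -> c1 <= y' <= e1 ->
      Rabs (P x' y' - P x y - (p * (x' - x) + q * (y' - y))) <= eps / 4 * t).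
    { intros x' y' Hx' Hy'.
      eapply Rle_trans; [apply Hd1; apply Rabs_lt_between'; lra|].
      apply Rmult_le_compat_l; [lra|]. unfold t.
      apply Rmax_lub; apply Rabs_le_between'; lra. }
    assert (KQ : forall x' y', a1 <= x' <= b1 -> c1 <= y' <= e1 ->
      Rabs (Q x' y' - Q x y - (q * (x' - x) + r * (y' - y))) <= eps / 4 * t).
    { intros x' y' Hx' Hy'.
      eapply Rle_trans; [apply Hd2; apply Rabs_lt_between'; lra|].
      apply Rmult_le_compat_l; [lra|]. unfold t.
      apply Rmax_lub; apply Rabs_le_between'; lra. }
    (* Each difference of opposite sides is constant up to [eps / 2 * t]. The linear parts
       [(b1 - a1) * (q * (c1 - e1))] and [(e1 - c1) * (q * (b1 - a1))] cancel because [q] is the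
       same for [P] and [Q]. *)
    assert (K1 := RInt_diff_bound (fun x => P x c1) (fun x => P x e1) a1 b1 (q * (c1 - e1))
      (eps / 2 * t)).
    assert (K2 := RInt_diff_bound (fun y => Q b1 y) (fun y => Q a1 y) c1 e1 (q * (b1 - a1))
      (eps / 2 * t)).
    assert (K1' : Rabs (RInt (fun x0 : R => P x0 c1) a1 b1 - RInt (fun x0 : R => P x0 e1) a1 b1 -
       (b1 - a1) * (q * (c1 - e1))) <= (b1 - a1) * (eps / 2 * t)).
    { apply K1; try (apply HP; lra); try lra. intros z Hz.
      pose proof (KP z c1 ltac:(lra) ltac:(lra)) as G1.
      pose proof (KP z e1 ltac:(lra) ltac:(lra)) as G2.
      apply Rabs_le_between in G1. apply Rabs_le_between in G2.
      apply Rabs_le_between. split; lra. }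
    assert (K2' : Rabs (RInt (fun y => Q b1 y) c1 e1 - RInt (fun y => Q a1 y) c1 e1 -
       (e1 - c1) * (q * (b1 - a1))) <= (e1 - c1) * (eps / 2 * t)).
    { apply K2; try (apply HQ; lra); try lra. intros z Hz.
      pose proof (KQ b1 z ltac:(lra) ltac:(lra)) as G1.
      pose proof (KQ a1 z ltac:(lra) ltac:(lra)) as G2.
      apply Rabs_le_between in G1. apply Rabs_le_between in G2.
      apply Rabs_le_between. split; lra. }
    apply Rabs_le_between in K1'. apply Rabs_le_between in K2'.
    fold t. unfold J. assert (0 <= t) by (unfold t; lra).
    assert (0 <= eps * (t * t)) by (apply Rmult_le_pos; nra).
    assert ((b1 - a1) * (eps / 2 * t) + (e1 - c1) * (eps / 2 * t) = eps * (t * t) / 2)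
      by (unfold t; field).
    apply Rabs_le_between. split; lra.
Qed.

(** * Differentiation rules in two real variables and polar coordinates *)

Lemma differentiable_pt_lim_mult2 (x y : R) :
  differentiable_pt_lim (fun u v => u * v) x y y x.
Proof.
  intros eps. exists eps. intros u v Hu Hv.
  replace (u * v - x * y - (y * (u - x) + x * (v - y))) with ((u - x) * (v - y)) by ring.
  rewrite Rabs_mult. apply Rmult_le_compat; try apply Rabs_pos; [lra | apply Rmax_r].
Qed.

Lemma differentiable_pt_lim_proj2 (f : R -> R) (x y l : R) :
  derivable_pt_lim f y l -> differentiable_pt_lim (fun _ v => f v) x y 0 l.
Proof.
  intros H eps. destruct (H eps (cond_pos eps)) as [d Hd].
  exists d. intros u v Hu Hv.
  apply Rle_trans with (eps * Rabs (v - y)).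
  2: { apply Rmult_le_compat_l; [left; apply cond_pos | apply Rmax_r]. }
  destruct (Req_dec v y) as [-> | Hne].
  - replace (f y - f y - (0 * (u - x) + l * (y - y))) with 0 by ring.
    rewrite Rabs_R0. apply Rmult_le_pos; [left; apply cond_pos | apply Rabs_pos].
  - assert (Hh : v - y <> 0) by lra.
    specialize (Hd (v - y) Hh Hv). replace (y + (v - y)) with v in Hd by ring.
    replace (f v - f y - (0 * (u - x) + l * (v - y)))
      with (((f v - f y) / (v - y) - l) * (v - y)) by (field; lra).
    rewrite Rabs_mult. apply Rmult_le_compat_r; [apply Rabs_pos | lra].
Qed.

Lemma differentiable_pt_lim_mult (f g : R -> R -> R) (x y p q p' q' : R) :
  differentiable_pt_lim f x y p q -> differentiable_pt_lim g x y p' q' ->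
  differentiable_pt_lim (fun u v => f u v * g u v) x y
    (g x y * p + f x y * p') (g x y * q + f x y * q').
Proof.
  intros Hf Hg.
  apply (differentiable_pt_lim_comp (fun u v => u * v) f g); auto.
  apply differentiable_pt_lim_mult2.
Qed.

Lemma differentiable_pt_lim_shift (f : R -> R -> R) (k x y p q : R) :
  differentiable_pt_lim f x y p q ->
  differentiable_pt_lim (fun u v => k + f u v) x y p q.
Proof.
  intros H eps. destruct (H eps) as [d Hd]. exists d. intros u v Hu Hv.
  replace (k + f u v - (k + f x y)) with (f u v - f x y) by ring. auto.
Qed.

Lemma differentiable_polar (h : R -> R) (k rho theta l : R) :
  derivable_pt_lim h theta l ->
  differentiable_pt_lim (fun u v => k + u * h v) rho theta (h theta) (rho * l).
Proof.
  intros H. apply differentiable_pt_lim_shift.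
  assert (H1 := differentiable_pt_lim_mult (fun u _ => u) (fun _ v => h v) rho theta 1 0 0 l
    (differentiable_pt_lim_proj1_0 (fun u => u) _ _ _ (derivable_pt_lim_id _))
    (differentiable_pt_lim_proj2 h rho theta l H)).
  simpl in H1.
  replace (h theta * 1 + rho * 0) with (h theta) in H1 by ring.
  replace (h theta * 0 + rho * l) with (rho * l) in H1 by ring.
  exact H1.
Qed.

(** * Rules for the complex derivative *)

Notation is_C_derive := (@is_derive C_AbsRing C_NormedModule).

Lemma is_C_derive_eps (g : C -> C) (z l : C) :
  is_C_derive g z l <->
  forall eps : posreal, exists d : posreal, forall w : C, Cmod (w - z) < d ->
    Cmod (g w - g z - (w - z) * l) <= eps * Cmod (w - z).
Proof.
  split.
  - intros [_ H] eps.
    destruct (H z (fun P HP => HP) eps) as [d Hd].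
    exists d. intros w Hw. exact (Hd w Hw).
  - intros H. split; [apply (@is_linear_scal_l C_AbsRing C_NormedModule)|].
    intros z' Hz' eps.
    rewrite <- (@is_filter_lim_locally_unique C_AbsRing (AbsRing_NormedModule C_AbsRing) z z' Hz').
    destruct (H eps) as [d Hd]. exists d. intros w Hw. exact (Hd w Hw).
Qed.

(** [C_differentiable] refers to [C_NormedModule], whereas the product rule, the identity and the
    inner function of a composition live over [C] as a module over itself; both structures give the
    same epsilon-delta condition. *)
Lemma is_C_derive_AbsRing (g : C -> C) (z l : C) :
  is_C_derive g z l <-> @is_derive C_AbsRing (AbsRing_NormedModule C_AbsRing) g z l.
Proof.
  rewrite is_C_derive_eps. split.
  - intros H.
    split; [apply (@is_linear_scal_l C_AbsRing (AbsRing_NormedModule C_AbsRing))|].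
    intros z' Hz' eps.
    rewrite <- (@is_filter_lim_locally_unique C_AbsRing (AbsRing_NormedModule C_AbsRing) z z' Hz').
    destruct (H eps) as [d Hd]. exists d. intros w Hw. exact (Hd w Hw).
  - intros [_ H] eps.
    destruct (H z (fun P HP => HP) eps) as [d Hd].
    exists d. intros w Hw. exact (Hd w Hw).
Qed.

Lemma is_C_derive_continuous (g : C -> C) (z l : C) :
  is_C_derive g z l ->
  forall eps, 0 < eps -> exists d, 0 < d /\ forall w, Cmod (w - z) < d -> Cmod (g w - g z) < eps.
Proof.
  intros H eps He. rewrite is_C_derive_eps in H.
  destruct (H (mkposreal 1 Rlt_0_1)) as [d Hd]; simpl in Hd.
  pose proof (Cmod_ge_0 l) as Hl.
  exists (Rmin d (eps / (2 + Cmod l))). split.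
  - apply Rmin_pos; [apply cond_pos | apply Rdiv_lt_0_compat; lra].
  - intros w Hw.
    pose proof (Rlt_le_trans _ _ _ Hw (Rmin_l _ _)) as H1.
    pose proof (Rlt_le_trans _ _ _ Hw (Rmin_r _ _)) as H2.
    apply Rlt_div_r in H2; [|lra].
    specialize (Hd w H1).
    replace (g w - g z)%C with ((g w - g z - (w - z) * l) + (w - z) * l)%C by ring.
    eapply Rle_lt_trans; [apply Cmod_triangle|]. rewrite Cmod_mult.
    pose proof (Cmod_ge_0 (w - z)).  nra.
Qed.

Lemma C_differentiable_const (k z : C) : C_differentiable (fun _ => k) z.
Proof. exists zero. apply (@is_derive_const C_AbsRing C_NormedModule). Qed.

Lemma C_differentiable_id (z : C) : C_differentiable (fun w => w) z.
Proof.
  exists (RtoC 1). apply is_C_derive_AbsRing. exact (@is_derive_id C_AbsRing z).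
Qed.

Lemma is_C_derive_plus (f g : C -> C) (z l m : C) :
  is_C_derive f z l -> is_C_derive g z m -> is_C_derive (fun w => f w + g w)%C z (l + m)%C.
Proof. apply (@is_derive_plus C_AbsRing C_NormedModule). Qed.

Lemma is_C_derive_minus (f g : C -> C) (z l m : C) :
  is_C_derive f z l -> is_C_derive g z m -> is_C_derive (fun w => f w - g w)%C z (l - m)%C.
Proof. apply (@is_derive_minus C_AbsRing C_NormedModule). Qed.

Lemma is_C_derive_mult (f g : C -> C) (z l m : C) :
  is_C_derive f z l -> is_C_derive g z m ->
  is_C_derive (fun w => f w * g w)%C z (l * g z + f z * m)%C.
Proof.
  rewrite !is_C_derive_AbsRing. intros Hf Hg.
  apply (@is_derive_mult C_AbsRing f g z l m Hf Hg Cmult_comm).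
Qed.

Lemma is_C_derive_inv_id (z : C) :
  z <> 0%C -> is_C_derive (fun w => / w)%C z (- (1) / (z * z))%C.
Proof.
  intros Hz. apply is_C_derive_eps. intros eps.
  assert (Hm : 0 < Cmod z) by (apply Cmod_gt_0; exact Hz).
  (* The first bound forces [|w| > |z| / 2]; the second then controls [|w - z| / (|w| |z|^2)], the
     factor left by [1/w - 1/z + (w - z)/z^2 = (w - z)^2 / (w z^2)]. *)
  assert (Hd : 0 < Rmin (Cmod z / 2) (eps * (Cmod z * Cmod z * Cmod z) / 2)).
  { pose proof (cond_pos eps). apply Rmin_pos; [lra|].
    apply Rdiv_lt_0_compat; [|lra]. repeat apply Rmult_lt_0_compat; lra. }
  exists (mkposreal _ Hd); simpl. intros w Hw.
  pose proof (Rlt_le_trans _ _ _ Hw (Rmin_l _ _)) as H1.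
  pose proof (Rlt_le_trans _ _ _ Hw (Rmin_r _ _)) as H2.
  assert (Hw2 : Cmod z / 2 < Cmod w).
  { pose proof (Cmod_triangle w (z - w)) as H.
    replace (w + (z - w))%C with z in H by ring.
    rewrite <- (Cmod_opp (z - w)) in H.
    replace (- (z - w))%C with (w - z)%C in H by ring. lra. }
  assert (Hw0 : w <> 0%C) by (apply Cmod_gt_0; lra).
  replace (/ w - / z - (w - z) * (- (1) / (z * z)))%C
    with ((w - z) * ((w - z) / (w * (z * z))))%C by (field; auto).
  rewrite Cmod_mult, Rmult_comm. apply Rmult_le_compat_r; [apply Cmod_ge_0|].
  rewrite Cmod_div by (repeat apply Cmult_neq_0; assumption).
  rewrite !Cmod_mult.
  assert (0 < Cmod z * Cmod z) by nra.
  apply Rle_div_l; [nra|]. pose proof (cond_pos eps).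
  assert (eps * (Cmod z * Cmod z * Cmod z) / 2 <= eps * (Cmod w * (Cmod z * Cmod z))).
  { unfold Rdiv; rewrite Rmult_assoc. apply Rmult_le_compat_l; [lra|]. nra. }
  lra.
Qed.

Lemma is_C_derive_inv (g : C -> C) (z l : C) :
  is_C_derive g z l -> g z <> 0%C ->
  is_C_derive (fun w => / g w)%C z (l * (- (1) / (g z * g z)))%C.
Proof.
  intros Hg Hz.
  apply (@is_derive_comp C_AbsRing C_NormedModule (fun w => / w)%C g z).
  - apply is_C_derive_inv_id, Hz.
  - apply is_C_derive_AbsRing, Hg.
Qed.

Lemma C_differentiable_plus (f g : C -> C) (z : C) :
  C_differentiable f z -> C_differentiable g z -> C_differentiable (fun w => f w + g w)%C z.
Proof. intros [l Hl] [m Hm]; eexists; apply is_C_derive_plus; eassumption. Qed.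

Lemma C_differentiable_minus (f g : C -> C) (z : C) :
  C_differentiable f z -> C_differentiable g z -> C_differentiable (fun w => f w - g w)%C z.
Proof. intros [l Hl] [m Hm]; eexists; apply is_C_derive_minus; eassumption. Qed.

Lemma C_differentiable_mult (f g : C -> C) (z : C) :
  C_differentiable f z -> C_differentiable g z -> C_differentiable (fun w => f w * g w)%C z.
Proof. intros [l Hl] [m Hm]; eexists; apply is_C_derive_mult; eassumption. Qed.

Lemma C_differentiable_div (f g : C -> C) (z : C) :
  C_differentiable f z -> C_differentiable g z -> g z <> 0%C ->
  C_differentiable (fun w => f w / g w)%C z.
Proof.
  intros Hf [m Hm] Hz. apply C_differentiable_mult; [exact Hf|].
  eexists; apply is_C_derive_inv; eassumption.
Qed.

Lemma is_C_derive_sharp (g : C -> C) (z l : C) :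
  is_C_derive g (Cconj z) l -> is_C_derive (sharp g) z (Cconj l).
Proof.
  rewrite !is_C_derive_eps. intros H eps. destruct (H eps) as [d Hd].
  exists d. intros w Hw.
  replace (w - z)%C with (Cconj (Cconj w - Cconj z)) in Hw
    by (rewrite Cminus_conj, !Cconj_conj; reflexivity).
  rewrite Cmod_conj in Hw. specialize (Hd _ Hw).
  unfold sharp.
  replace (w - z)%C with (Cconj (Cconj w - Cconj z))
    by (rewrite Cminus_conj, !Cconj_conj; reflexivity).
  rewrite <- Cmult_conj, <- !Cminus_conj, !Cmod_conj.
  rewrite <- (Cmod_conj (w - z)), !Cminus_conj. exact Hd.
Qed.

Lemma C_differentiable_sharp (g : C -> C) (z : C) : entire g -> C_differentiable (sharp g) z.
Proof. intros Hg; destruct (Hg (Cconj z)) as [l Hl]; eexists; apply is_C_derive_sharp, Hl. Qed.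

(** * Cauchy-Riemann equations and means over circles *)

Lemma im_le_Cmod (z : C) : Rabs (Im z) <= Cmod z.
Proof.
  eapply Rle_trans; [apply Rmax_r | apply Rmax_Cmod].
Qed.

Lemma Cmod_lt_of_coords (z : C) (d : R) :
  Rabs (Re z) < d / 2 -> Rabs (Im z) < d / 2 -> Cmod z < d.
Proof.
  intros H1 H2.
  replace z with (RtoC (Re z) + Ci * RtoC (Im z))%C
    by (destruct z; unfold Ci, RtoC, Cmult, Cplus; simpl; f_equal; ring).
  eapply Rle_lt_trans; [apply Cmod_triangle|].
  rewrite Cmod_mult, Cmod_Ci, !Cmod_R. lra.
Qed.

Lemma Cmod_le_2Rmax (z : C) : Cmod z <= 2 * Rmax (Rabs (Re z)) (Rabs (Im z)).
Proof.
  replace z with (RtoC (Re z) + Ci * RtoC (Im z))%C at 1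
    by (destruct z; unfold Ci, RtoC, Cmult, Cplus; simpl; f_equal; ring).
  eapply Rle_trans; [apply Cmod_triangle|].
  rewrite Cmod_mult, Cmod_Ci, !Cmod_R.
  pose proof (Rmax_l (Rabs (Re z)) (Rabs (Im z))).
  pose proof (Rmax_r (Rabs (Re z)) (Rabs (Im z))). lra.
Qed.

(** Multiplication by [l] is the real-linear map with rows [(Re l, - Im l)] and [(Im l, Re l)]. The
    factor 2 between [Cmod] and the maximum norm is absorbed by halving both [eps] and [d]. *)
Lemma cauchy_riemann (g : C -> C) (x y : R) (l : C) :
  is_C_derive g (x, y) l ->
  differentiable_pt_lim (fun u v => Re (g (u, v))) x y (Re l) (- Im l) /\
  differentiable_pt_lim (fun u v => Im (g (u, v))) x y (Im l) (Re l).
Proof.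
  intros H. rewrite is_C_derive_eps in H.
  assert (K : forall eps : posreal, locally_2d (fun u v =>
    Cmod (g (u, v) - g (x, y) - ((u, v) - (x, y)) * l)%C <=
      eps * Rmax (Rabs (u - x)) (Rabs (v - y))) x y).
  { intros eps. destruct (H (pos_div_2 eps)) as [d Hd].
    exists (pos_div_2 d); simpl in *. intros u v Hu Hv.
    eapply Rle_trans; [apply Hd; apply Cmod_lt_of_coords; assumption|].
    pose proof (Cmod_le_2Rmax ((u, v) - (x, y))) as H1.
    simpl in H1. pose proof (cond_pos eps). unfold Rminus. nra. }
  split; intros eps; destruct (K eps) as [d Hd]; exists d; intros u v Hu Hv;
    (eapply Rle_trans; [|apply (Hd u v Hu Hv)]).
  - eapply Rle_trans; [|apply re_le_Cmod]. right; f_equal.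
    destruct l; unfold Re, Im; simpl; ring.
  - eapply Rle_trans; [|apply im_le_Cmod]. right; f_equal.
    destruct l; unfold Re, Im; simpl; ring.
Qed.

(* The form [Im k / rho drho + Re k dtheta] is closed, so the mean of [Re k] over
   circles around [z0] does not depend on the radius. *)
Lemma mean_value_inequality (k : C -> C) (z0 : C) (r delta : R) :
  0 < r -> 0 < delta -> (forall z, Cmod (z - z0) <= r -> C_differentiable k z) ->
  ~ (forall z, Cmod (z - z0) = r -> Re (k z) <= Re (k z0) - delta).
Proof.
  intros Hr Hdelta Hk Hle.
  set (pt := fun rho theta => (Re z0 + rho * cos theta, Im z0 + rho * sin theta) : C).
  assert (Hpt : forall rho theta, 0 < rho -> Cmod (pt rho theta - z0) = rho).
  { intros rho theta Hrho. unfold Cmod, pt. simpl.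
    replace ((Re z0 + rho * cos theta + - fst z0) * ((Re z0 + rho * cos theta + - fst z0) * 1)
      + (Im z0 + rho * sin theta + - snd z0) * ((Im z0 + rho * sin theta + - snd z0) * 1))
      with (rho * rho * (Rsqr (sin theta) + Rsqr (cos theta)))
      by (unfold Re, Im, Rsqr; ring).
    rewrite sin2_cos2, Rmult_1_r. apply sqrt_square; lra. }
  destruct (Hk z0) as [l0 Hl0].
  { replace (z0 - z0)%C with (RtoC 0) by ring. rewrite Cmod_0; lra. }
  destruct (is_C_derive_continuous k z0 l0 Hl0 (delta / 2)) as [d [Hd Hcont]]; [lra|].
  (* The circle of radius [eta] avoids the centre, where [/ rho] is singular, and is small enough
     for [Re k] to stay above [Re (k z0) - delta / 2] on it. *)
  set (eta := Rmin r d / 2).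
  assert (Heta : 0 < eta /\ eta < r /\ eta < d).
  { pose proof (Rmin_l r d); pose proof (Rmin_r r d).
    assert (0 < Rmin r d) by (apply Rmin_pos; assumption). unfold eta; lra. }
  set (Q := fun rho theta => Re (k (pt rho theta))).
  set (P := fun rho theta => / rho * Im (k (pt rho theta))).
  pose proof PI_RGT_0 as HPI.
  assert (HD : forall rho theta, eta <= rho <= r -> exists p q s,
    differentiable_pt_lim P rho theta p q /\ differentiable_pt_lim Q rho theta q s).
  { intros rho theta Hrho.
    destruct (Hk (pt rho theta)) as [l Hl]; [rewrite Hpt; lra|].
    destruct (cauchy_riemann k _ _ l Hl) as [H1 H2].
    assert (D1 := differentiable_polar cos (Re z0) rho theta _ (derivable_pt_lim_cos theta)).
    assert (D2 := differentiable_polar sin (Im z0) rho theta _ (derivable_pt_lim_sin theta)).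
    assert (DQ := differentiable_pt_lim_comp _ _ _ _ _ _ _ _ _ _ _ H1 D1 D2).
    assert (DI := differentiable_pt_lim_comp _ _ _ _ _ _ _ _ _ _ _ H2 D1 D2).
    assert (Dinv : differentiable_pt_lim (fun u _ => / u) rho theta (- / rho ^ 2) 0).
    { apply (differentiable_pt_lim_proj1_0 (fun u => / u)).
      apply is_derive_Reals. auto_derive; [lra | field; lra]. }
    assert (DP := differentiable_pt_lim_mult _ _ _ _ _ _ _ _ Dinv DI).
    eexists; eexists; eexists; split; [|exact DQ].
    (* The Cauchy-Riemann equations in polar form: the [theta]-derivative of [P] equals the
       [rho]-derivative of [Q]. *)
    cbv beta in DP.
    match type of DP with differentiable_pt_lim _ _ _ ?p ?q =>
      match type of DQ with differentiable_pt_lim _ _ _ ?q' _ =>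
        replace q with q' in DP by (field; lra) end end.
    exact DP. }
  assert (HQ : forall rho, eta <= rho <= r -> ex_RInt (fun t => Q rho t) 0 (2 * PI)).
  { intros rho Hrho. apply (@ex_RInt_continuous R_CompleteNormedModule). intros t _.
    destruct (HD rho t Hrho) as (p & q & s & _ & H).
    apply (differentiable_slice_r Q rho t q s H). }
  assert (G := green_rectangle P Q eta r 0 (2 * PI) ltac:(lra) ltac:(lra)
    (fun x y Hx _ => HD x y Hx)).
  (* The sides [theta = 0] and [theta = 2 PI] are the same segment in the plane, so Green's identity
     leaves equal integrals of [Q] at the radii [eta] and [r]; [U] and [L] contradict this
     equality. *)
  assert (E : RInt (fun x => P x 0) eta r = RInt (fun x => P x (2 * PI)) eta r).
  { apply RInt_ext. intros x _. unfold P, pt. rewrite cos_2PI, sin_2PI, cos_0, sin_0.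
    reflexivity. }
  assert (U : RInt (fun y => Q r y) 0 (2 * PI) <= RInt (fun _ => Re (k z0) - delta) 0 (2 * PI)).
  { apply RInt_le; [lra | apply HQ; lra | apply ex_RInt_const |].
    intros t _. apply Hle, Hpt, Hr. }
  assert (L : RInt (fun _ => Re (k z0) - delta / 2) 0 (2 * PI) <=
    RInt (fun y => Q eta y) 0 (2 * PI)).
  { apply RInt_le; [lra | apply ex_RInt_const | apply HQ; lra |].
    intros t _. assert (Hc : Cmod (pt eta t - z0) < d) by (rewrite Hpt; lra).
    specialize (Hcont _ Hc).
    pose proof (re_le_Cmod (k (pt eta t) - k z0)) as H1.
    apply Rabs_le_between in H1. unfold Q. simpl in H1.
    unfold Re in *. lra. }
  assert (E1 := @RInt_const R_CompleteNormedModule 0 (2 * PI) (Re (k z0) - delta)).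
  assert (E2 := @RInt_const R_CompleteNormedModule 0 (2 * PI) (Re (k z0) - delta / 2)).
  unfold scal in E1, E2; simpl in E1, E2; unfold mult in E1, E2; simpl in E1, E2.
  nra.
Qed.

(** * Compactness and the maximum principle *)

Lemma Re_minus (a b : C) : Re (a - b)%C = Re a - Re b.
Proof. reflexivity. Qed.

Lemma Im_minus (a b : C) : Im (a - b)%C = Im a - Im b.
Proof. reflexivity. Qed.

Lemma Cmod_minus_sym (a b : C) : Cmod (a - b) = Cmod (b - a).
Proof. rewrite <- Cmod_opp. f_equal. ring. Qed.

Lemma Cmod_le_add_dist (a b : C) : Cmod a <= Cmod b + Cmod (a - b).
Proof.
  replace a with (b + (a - b))%C at 1 by ring. apply Cmod_triangle.
Qed.

Lemma Im_dist_bounds (a b : C) : Im b - Cmod (a - b) <= Im a <= Im b + Cmod (a - b).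
Proof.
  pose proof (im_le_Cmod (a - b)) as H. rewrite Im_minus in H.
  apply Rabs_le_between in H. lra.
Qed.

Definition closed_C (K : C -> Prop) : Prop :=
  forall z, ~ K z -> exists d, 0 < d /\ forall w, Cmod (w - z) < d -> ~ K w.

(** Without a maximum, each point of [K] is beaten by another one, which by upper semicontinuity
    beats a whole neighbourhood. That a single point of [K] beats all of [K] in a rectangle is
    inherited from the quarters, by taking the best of four witnesses; on a square containing [K]
    that point would beat itself. *)
Lemma compact_max (K : C -> Prop) (h : C -> R) (rad : R) :
  (exists z, K z) -> (forall z, K z -> Cmod z <= rad) -> closed_C K ->
  (forall z, K z -> forall eps, 0 < eps ->
     exists d, 0 < d /\ forall w, Cmod (w - z) < d -> h w < h z + eps) ->
  exists z0, K z0 /\ forall z, K z -> h z <= h z0.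
Proof.
  intros [z1 Hz1] Hrad Hcl Hh. apply NNPP; intros Hno.
  assert (Hup : forall z, K z -> exists w, K w /\ h z < h w).
  { intros z Hz. apply NNPP; intros H. apply Hno. exists z; split; [exact Hz|].
    intros w Hw. apply Rnot_lt_le; intros Hlt. apply H; exists w; tauto. }
  assert (Hr : 0 <= rad) by (eapply Rle_trans; [apply Cmod_ge_0 | apply (Hrad _ Hz1)]).
  assert (HP : exists w, K w /\ forall z, K z -> - rad <= Re z <= rad ->
     - rad <= Im z <= rad -> h z < h w).
  { apply (cousin_rectangle (fun a b c d => exists w, K w /\ forall z, K z ->
       a <= Re z <= b -> c <= Im z <= d -> h z < h w)); try lra.
    - intros a b c d Ha Hb Hc Hd (w1 & K1 & H1) (w2 & K2 & H2) (w3 & K3 & H3) (w4 & K4 & H4).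
      assert (Hw : exists w, K w /\ h w1 <= h w /\ h w2 <= h w /\ h w3 <= h w /\ h w4 <= h w).
      { destruct (Rle_dec (h w1) (h w2)), (Rle_dec (h w3) (h w4)).
        - destruct (Rle_dec (h w2) (h w4)); [exists w4 | exists w2]; repeat split; auto; lra.
        - destruct (Rle_dec (h w2) (h w3)); [exists w3 | exists w2]; repeat split; auto; lra.
        - destruct (Rle_dec (h w1) (h w4)); [exists w4 | exists w1]; repeat split; auto; lra.
        - destruct (Rle_dec (h w1) (h w3)); [exists w3 | exists w1]; repeat split; auto; lra. }
      destruct Hw as (w & Kw & L1 & L2 & L3 & L4). exists w; split; [exact Kw|].
      intros z Kz Hx Hy.
      destruct (Rle_dec (Re z) ((a + b) / 2)), (Rle_dec (Im z) ((c + d) / 2)).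
      + specialize (H1 z Kz ltac:(lra) ltac:(lra)); lra.
      + specialize (H3 z Kz ltac:(lra) ltac:(lra)); lra.
      + specialize (H2 z Kz ltac:(lra) ltac:(lra)); lra.
      + specialize (H4 z Kz ltac:(lra) ltac:(lra)); lra.
    - intros x y Hx Hy.
      assert (Hloc : exists d, 0 < d /\ exists w, K w /\ forall z, K z ->
        Cmod (z - (x, y)) < d -> h z < h w).
      { destruct (classic (K (x, y))) as [Kz | Kz].
        - destruct (Hup _ Kz) as [w [Kw Hw]].
          destruct (Hh _ Kz (h w - h (x, y))) as [d [Hd H]]; [lra|].
          exists d; split; [exact Hd|]. exists w; split; [exact Kw|].
          intros z _ Hz. specialize (H z Hz). lra.
        - destruct (Hcl _ Kz) as [d [Hd H]]. exists d; split; [exact Hd|].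
          exists z1; split; [exact Hz1|]. intros z Hz Hzd. destruct (H z Hzd Hz). }
      destruct Hloc as (d & Hd & w & Kw & H). exists (d / 2); split; [lra|].
      intros a b c e Ha Hb Hc He Hs1 Hs2. exists w; split; [exact Kw|].
      intros z Kz Hzx Hzy. apply H; [exact Kz|].
      apply Cmod_lt_of_coords; unfold Re, Im in *; simpl; apply Rabs_def1; lra. }
  destruct HP as [w [Kw Hw]].
  assert (h w < h w); [|lra]. apply Hw; [exact Kw| |].
  - apply Rabs_le_between. eapply Rle_trans; [apply re_le_Cmod | apply Hrad, Kw].
  - apply Rabs_le_between. eapply Rle_trans; [apply im_le_Cmod | apply Hrad, Kw].
Qed.

Lemma sqr_upper_semicontinuous (a e : R) :
  0 <= a -> 0 < e -> exists eta, 0 < eta /\ forall b, 0 <= b < a + eta -> b ^ 2 < a ^ 2 + e.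
Proof.
  intros Ha He.
  assert (H1 : 0 < e / (2 * a + 2)) by (apply Rdiv_lt_0_compat; lra).
  exists (Rmin 1 (e / (2 * a + 2))). split; [apply Rmin_pos; lra|].
  intros b Hb.
  pose proof (Rmin_l 1 (e / (2 * a + 2))). pose proof (Rmin_r 1 (e / (2 * a + 2))) as H2.
  set (eta := Rmin 1 (e / (2 * a + 2))) in *.
  assert (H0 : 0 < eta) by (apply Rmin_pos; lra).
  apply Rle_div_r in H2; [|lra].
  assert (b ^ 2 <= (a + eta) ^ 2) by (apply pow_incr; lra). nra.
Qed.

(** Polarisation. With [a] fixed, it relates [|b|^2], which is not harmonic in [b], to the real part
    of a function analytic in [b]. *)
Lemma Re_conj_mult (a b : C) :
  Re (Cconj a * b)%C = (Cmod a ^ 2 + Cmod b ^ 2 - Cmod (b - a) ^ 2) / 2.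
Proof.
  rewrite !Cmod2_alt. destruct a, b; unfold Re, Im; simpl. field.
Qed.

(* A maximum point [z0] of [|g|^2 + eps |z|^2] cannot be interior: the mean value
   inequality fails there for [conj (g z0) g + eps conj z0 z]. *)
Lemma maximum_modulus (K S : C -> Prop) (g : C -> C) (rad m : R) :
  0 <= m -> (forall z, K z -> Cmod z <= rad) -> closed_C K ->
  (forall z, K z -> S z \/ exists r, 0 < r /\ forall w, Cmod (w - z) <= r -> K w) ->
  (forall z, K z -> C_differentiable g z) ->
  (forall z, K z -> S z -> Cmod (g z) <= m) ->
  forall z, K z -> Cmod (g z) <= m.
Proof.
  intros Hm Hrad Hcl Hint Hg HS z1 Hz1. apply Rnot_lt_le; intros Hlt.
  assert (Hr : 0 <= rad) by (eapply Rle_trans; [apply Cmod_ge_0 | apply (Hrad _ Hz1)]).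
  (* Small enough that [eps * rad ^ 2] stays below the excess of [|g z1|^2] over [m ^ 2]; hence the
     perturbed function cannot have its maximum in [S]. *)
  set (eps := (Cmod (g z1) ^ 2 - m ^ 2) / (2 * (rad ^ 2 + 1))).
  assert (Hd : 0 < Cmod (g z1) ^ 2 - m ^ 2) by nra.
  assert (Heps : 0 < eps) by (apply Rdiv_lt_0_compat; nra).
  assert (Hepsr : m ^ 2 + eps * rad ^ 2 < Cmod (g z1) ^ 2).
  { assert (eps * (rad ^ 2 + 1) = (Cmod (g z1) ^ 2 - m ^ 2) / 2)
      by (unfold eps; field; nra). nra. }
  destruct (compact_max K (fun z => Cmod (g z) ^ 2 + eps * Cmod z ^ 2) rad)
    as [z0 [Kz0 Hz0]]; eauto.
  { intros z Kz e He. destruct (Hg z Kz) as [l Hl].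
    destruct (sqr_upper_semicontinuous (Cmod (g z)) (e / 2)) as [e1 [He1 H1]];
      [apply Cmod_ge_0 | lra |].
    destruct (sqr_upper_semicontinuous (Cmod z) (e / 2 / eps)) as [e2 [He2 H2]];
      [apply Cmod_ge_0 | apply Rdiv_lt_0_compat; lra |].
    destruct (is_C_derive_continuous g z l Hl e1 He1) as [d [Hd0 Hd1]].
    exists (Rmin d e2); split; [apply Rmin_pos; assumption|]. intros w Hw.
    pose proof (Rmin_l d e2); pose proof (Rmin_r d e2).
    specialize (Hd1 w ltac:(lra)).
    pose proof (Cmod_le_add_dist (g w) (g z)). pose proof (Cmod_le_add_dist w z).
    specialize (H1 (Cmod (g w)) ltac:(pose proof (Cmod_ge_0 (g w)); lra)).
    specialize (H2 (Cmod w) ltac:(pose proof (Cmod_ge_0 w); lra)).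
    apply (Rmult_lt_compat_l eps) in H2; [|lra]. rewrite Rmult_plus_distr_l in H2.
    replace (eps * (e / 2 / eps)) with (e / 2) in H2 by (field; lra). lra. }
  destruct (Hint z0 Kz0) as [Sz | [r [Hr0 Hball]]].
  { specialize (HS z0 Kz0 Sz). specialize (Hz0 z1 Hz1). specialize (Hrad z0 Kz0).
    pose proof (Cmod_ge_0 (g z0)). pose proof (Cmod_ge_0 z0). pose proof (Cmod_ge_0 z1).
    assert (0 <= eps * Cmod z1 ^ 2) by (apply Rmult_le_pos; nra).
    assert (eps * Cmod z0 ^ 2 <= eps * rad ^ 2) by (apply Rmult_le_compat_l; nra).
    assert (Cmod (g z0) ^ 2 <= m ^ 2) by nra. lra. }
  (* By polarisation, the real part drops on the circle by at least [eps * r ^ 2 / 2], the share of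
     [|z - z0|^2]. The perturbation [eps |z|^2] is there to make this drop strict even when [g] is
     constant. *)
  apply (mean_value_inequality
    (fun z => Cconj (g z0) * g z + RtoC eps * (Cconj z0 * z))%C z0 r (eps * r ^ 2 / 2) Hr0).
  - apply Rdiv_lt_0_compat; [|lra]. apply Rmult_lt_0_compat; nra.
  - intros z Hz. apply C_differentiable_plus; apply C_differentiable_mult.
    + apply C_differentiable_const.
    + apply Hg, Hball, Hz.
    + apply C_differentiable_const.
    + apply C_differentiable_mult; [apply C_differentiable_const | apply C_differentiable_id].
  - intros z Hz. assert (Kz : K z) by (apply Hball; lra).
    specialize (Hz0 z Kz). rewrite !re_plus, !re_scal_l, !Re_conj_mult, Hz.
    replace (g z0 - g z0)%C with (RtoC 0) by ring.
    replace (z0 - z0)%C with (RtoC 0) by ring. rewrite Cmod_0.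
    pose proof (pow2_ge_0 (Cmod (g z - g z0))). nra.
Qed.

(** * The Phragmén-Lindelöf principle in the upper half-plane *)

Lemma le_of_le_add_small (a m c : R) :
  0 < c -> (forall eps, 0 < eps < 1 -> a <= m + eps * c) -> a <= m.
Proof.
  intros Hc H. apply Rnot_lt_le; intros Hlt.
  assert (H0 : 0 < Rmin (1 / 2) ((a - m) / (2 * c))).
  { apply Rmin_pos; [lra | apply Rdiv_lt_0_compat; lra]. }
  pose proof (Rmin_l (1 / 2) ((a - m) / (2 * c))) as H1.
  pose proof (Rmin_r (1 / 2) ((a - m) / (2 * c))) as H2.
  specialize (H _ (conj H0 (Rle_lt_trans _ _ 1 H1 ltac:(lra)))).
  apply (Rmult_le_compat_r c) in H2; [|lra].
  replace ((a - m) / (2 * c) * c) with ((a - m) / 2) in H2 by (field; lra). lra.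
Qed.

Lemma closed_upper_half_disc (rho : R) : closed_C (fun w => 0 <= Im w /\ Cmod w <= rho).
Proof.
  intros z Hz. apply not_and_or in Hz. destruct Hz as [Hz | Hz].
  - exists (- Im z). split; [lra|]. intros w Hw [H _].
    pose proof (Im_dist_bounds w z). lra.
  - exists (Cmod z - rho). split; [lra|]. intros w Hw [_ H].
    pose proof (Cmod_le_add_dist z w) as H1. rewrite Cmod_minus_sym in H1. lra.
Qed.

(** Division by [e w = 1 - i eps w] makes the a priori bound [K] decay at infinity: the real part of
    [e w] is [1 + eps Im w >= 1], and [|e w|] grows linearly. On a large half-disc the diameter
    contributes at most [m] and the arc at most [eps], so [K] is gone when [eps] tends to 0. *)
Lemma phragmen_lindelof (h : C -> C) (K m : R) :
  0 <= m -> (forall z, 0 <= Im z -> C_differentiable h z) ->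
  (forall z, 0 < Im z -> Cmod (h z) <= K) ->
  (forall x : R, Cmod (h (RtoC x)) <= m) ->
  forall z, 0 <= Im z -> Cmod (h z) <= m.
Proof.
  intros Hm Hh HK HR z Hz.
  (* The constant comes from expanding [(m + eps) * (1 + eps * |z|)] with [eps ^ 2 <= eps]. *)
  apply (le_of_le_add_small _ m (1 + Cmod z + m * Cmod z)).
  { pose proof (Cmod_ge_0 z). nra. }
  intros eps Heps.
  set (e := fun w : C => (1 - Ci * RtoC eps * w)%C).
  assert (He : forall w, 0 <= Im w -> 1 <= Cmod (e w)).
  { intros w Hw. eapply Rle_trans; [|apply re_le_Cmod]. eapply Rle_trans; [|apply Rle_abs].
    unfold e. rewrite Re_minus, re_mult, re_RtoC. simpl. unfold Im in *. nra. }
  assert (He0 : forall w, 0 <= Im w -> e w <> 0%C).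
  { intros w Hw. apply Cmod_gt_0. specialize (He w Hw). lra. }
  assert (Heps_w : forall w, Cmod (Ci * RtoC eps * w) = eps * Cmod w).
  { intros w. rewrite !Cmod_mult, Cmod_Ci, Cmod_R, Rabs_pos_eq by lra. ring. }
  (* Makes [eps * rho - 1], a lower bound for [|e|] on the arc, at least [|K| / eps]; the summand
     [Cmod z] puts [z] inside the half-disc. *)
  set (rho := Cmod z + (1 + Rabs K / eps) / eps).
  assert (Hrho : eps * rho - 1 >= Rabs K / eps).
  { unfold rho. rewrite Rmult_plus_distr_l.
    replace (eps * ((1 + Rabs K / eps) / eps)) with (1 + Rabs K / eps) by (field; lra).
    pose proof (Cmod_ge_0 z). nra. }
  assert (HKe : 0 <= Rabs K / eps) by (apply Rdiv_le_0_compat; [apply Rabs_pos | lra]).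
  assert (Hmain : Cmod (h z / e z) <= m + eps).
  { apply (maximum_modulus (fun w => 0 <= Im w /\ Cmod w <= rho)
      (fun w => Im w = 0 \/ Cmod w = rho) (fun w => h w / e w)%C rho).
    - lra.
    - intros w [_ H]; exact H.
    - apply closed_upper_half_disc.
    - intros w [H1 H2].
      destruct (Req_dec (Im w) 0) as [E1|E1]; [tauto|].
      destruct (Req_dec (Cmod w) rho) as [E2|E2]; [tauto|]. right.
      exists (Rmin (Im w) (rho - Cmod w)). split; [apply Rmin_pos; lra|].
      intros v Hv. pose proof (Rmin_l (Im w) (rho - Cmod w)).
      pose proof (Rmin_r (Im w) (rho - Cmod w)).
      pose proof (Im_dist_bounds v w). pose proof (Cmod_le_add_dist v w). split; lra.
    - intros w [H1 _]. apply C_differentiable_div; [apply Hh, H1 | | apply He0, H1].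
      apply C_differentiable_minus; [apply C_differentiable_const|].
      apply C_differentiable_mult; [apply C_differentiable_const | apply C_differentiable_id].
    - intros w [H1 H2] HS. rewrite Cmod_div by (apply He0, H1).
      specialize (He w H1). apply Rle_div_l; [lra|].
      destruct (Req_dec (Im w) 0) as [E | E].
      + assert (Ew : w = RtoC (Re w)) by
          (destruct w; unfold Re, Im, RtoC in *; simpl in *; congruence).
        specialize (HR (Re w)). rewrite <- Ew in HR. nra.
      + destruct HS as [HS | HS]; [contradiction|].
        specialize (HK w ltac:(lra)).
        assert (Hew : Rabs K / eps <= Cmod (e w)).
        { pose proof (Cmod_le_add_dist (Ci * RtoC eps * w) 1) as H.
          rewrite Heps_w, HS, Cmod_1, Cmod_minus_sym in H. fold (e w) in H. lra. }
        apply Rle_div_l in Hew; [|lra]. pose proof (Rle_abs K). nra.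
    - split; [exact Hz|]. unfold rho.
      assert (0 <= (1 + Rabs K / eps) / eps) by (apply Rdiv_le_0_compat; lra). lra. }
  rewrite Cmod_div in Hmain by (apply He0, Hz).
  pose proof (He z Hz). apply Rle_div_l in Hmain; [|lra].
  assert (Cmod (e z) <= 1 + eps * Cmod z).
  { pose proof (Cmod_triangle 1 (- (Ci * RtoC eps * z))) as H1.
    rewrite Cmod_opp, Heps_w, Cmod_1 in H1. exact H1. }
  pose proof (Cmod_ge_0 z).
  assert ((m + eps) * Cmod (e z) <= (m + eps) * (1 + eps * Cmod z))
    by (apply Rmult_le_compat_l; lra).
  nra.
Qed.

(** * Real derivatives along lines and one-sided comparisons *)

Lemma is_C_derive_horizontal (g : C -> C) (x : R) (l : C) :
  is_C_derive g (RtoC x) l ->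
  is_derive (fun t => Re (g (RtoC t))) x (Re l) /\
  is_derive (fun t => Im (g (RtoC t))) x (Im l).
Proof.
  intros H. destruct (cauchy_riemann g x 0 l H) as [H1 H2].
  split; apply is_derive_Reals.
  - replace (Re l) with (Re l * 1 + - Im l * 0) by ring.
    apply (derivable_pt_lim_comp_2d (fun u v => Re (g (u, v))) (fun t => t) (fun _ => 0));
      [exact H1 | apply derivable_pt_lim_id | apply derivable_pt_lim_const].
  - replace (Im l) with (Im l * 1 + Re l * 0) by ring.
    apply (derivable_pt_lim_comp_2d (fun u v => Im (g (u, v))) (fun t => t) (fun _ => 0));
      [exact H2 | apply derivable_pt_lim_id | apply derivable_pt_lim_const].
Qed.

Lemma is_C_derive_vertical (g : C -> C) (x y : R) (l : C) :
  is_C_derive g (x, y) l ->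
  is_derive (fun t => Re (g (x, t))) y (- Im l) /\
  is_derive (fun t => Im (g (x, t))) y (Re l).
Proof.
  intros H. destruct (cauchy_riemann g x y l H) as [H1 H2].
  split; apply is_derive_Reals.
  - replace (- Im l) with (Re l * 0 + - Im l * 1) by ring.
    apply (derivable_pt_lim_comp_2d (fun u v => Re (g (u, v))) (fun _ => x) (fun t => t));
      [exact H1 | apply derivable_pt_lim_const | apply derivable_pt_lim_id].
  - replace (Re l) with (Im l * 0 + Re l * 1) by ring.
    apply (derivable_pt_lim_comp_2d (fun u v => Im (g (u, v))) (fun _ => x) (fun t => t));
      [exact H2 | apply derivable_pt_lim_const | apply derivable_pt_lim_id].
Qed.

Lemma right_derivative_nonneg (psi : R -> R) (x l b : R) :
  is_derive psi x l -> x < b -> (forall t, x < t < b -> psi x <= psi t) -> 0 <= l.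
Proof.
  intros H Hb Hpsi. apply is_derive_Reals in H. apply Rnot_lt_le; intros Hl.
  destruct (H (- l) ltac:(lra)) as [d Hd]. pose proof (cond_pos d).
  set (e := Rmin d (b - x) / 2).
  assert (He : 0 < e /\ e < d /\ e < b - x).
  { pose proof (Rmin_l d (b - x)); pose proof (Rmin_r d (b - x)).
    assert (0 < Rmin d (b - x)) by (apply Rmin_pos; lra). unfold e; lra. }
  specialize (Hd e ltac:(lra)). rewrite Rabs_pos_eq in Hd by lra.
  specialize (Hd ltac:(lra)). apply Rabs_def2 in Hd.
  specialize (Hpsi (x + e) ltac:(lra)).
  assert (0 <= (psi (x + e) - psi x) / e) by (apply Rdiv_le_0_compat; lra). lra.
Qed.

Lemma is_derive_reflect (w : R -> R) (x d : R) :
  is_derive w (- x) d -> is_derive (fun t => w (- t)) x (- d).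
Proof.
  intros H. replace (- d) with (- (1) * d) by ring.
  apply (is_derive_comp w Ropp); [exact H | auto_derive; auto].
Qed.

Lemma is_derive_odd_part (w : R -> R) (d : R) :
  is_derive w 0 d -> is_derive (fun t => w t - w (- t)) 0 (2 * d).
Proof.
  intros H. replace (2 * d) with (d - - d) by ring.
  apply (is_derive_minus w (fun t => w (- t))); [exact H|].
  apply is_derive_reflect. rewrite Ropp_0; exact H.
Qed.

Lemma is_derive_sqr_sum (u v : R -> R) (x u' v' : R) :
  is_derive u x u' -> is_derive v x v' ->
  is_derive (fun t => u t ^ 2 + v t ^ 2) x (2 * (u x * u' + v x * v')).
Proof.
  intros Hu Hv. auto_derive.
  - repeat split; eexists; eassumption.
  - replace (Derive (fun x => u x) x) with u' by (symmetry; apply is_derive_unique, Hu).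
    replace (Derive (fun x => v x) x) with v' by (symmetry; apply is_derive_unique, Hv).
    ring.
Qed.

Lemma minimum_derivative_zero (psi : R -> R) (x l : R) :
  is_derive psi x l -> (forall t, psi x <= psi t) -> l = 0.
Proof.
  intros H Hmin.
  assert (0 <= l) by (apply (right_derivative_nonneg psi x l (x + 1) H); auto; lra).
  assert (0 <= - l); [|lra].
  apply (right_derivative_nonneg (fun t => psi (- t)) (- x) (- l) (- x + 1)).
  - apply is_derive_reflect. rewrite Ropp_involutive; exact H.
  - lra.
  - intros t _. rewrite Ropp_involutive. apply Hmin.
Qed.

(** The function [|G(x + it)|^2 - |G(x - it)|^2] is 0 at [t = 0] and nonnegative for [t > 0]; by the
    Cauchy-Riemann equations its derivative at 0 is [4 (Im G * Re l - Re G * Im l)]. *)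
Lemma wronskian_of_hb (G : C -> C) (x : R) (l : C) :
  (forall z, 0 < Im z -> Cmod (G (Cconj z)) <= Cmod (G z)) ->
  is_C_derive G (RtoC x) l ->
  Re (G (RtoC x)) * Im l <= Re l * Im (G (RtoC x)).
Proof.
  intros HG Hl.
  destruct (is_C_derive_vertical G x 0 l Hl) as [D1 D2].
  set (psi := fun t => (Re (G (x, t)) ^ 2 + Im (G (x, t)) ^ 2) -
                       (Re (G (x, - t)) ^ 2 + Im (G (x, - t)) ^ 2)).
  assert (D : is_derive psi 0 (2 * (2 * (Re (G (RtoC x)) * - Im l + Im (G (RtoC x)) * Re l)))).
  { apply (is_derive_odd_part (fun t => Re (G (x, t)) ^ 2 + Im (G (x, t)) ^ 2)).
    exact (is_derive_sqr_sum _ _ _ _ _ D1 D2). }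
  enough (0 <= 2 * (2 * (Re (G (RtoC x)) * - Im l + Im (G (RtoC x)) * Re l))) by lra.
  apply (right_derivative_nonneg psi 0 _ 1 D); [lra|].
  intros t Ht. unfold psi. rewrite Ropp_0.
  specialize (HG (x, t) ltac:(simpl; lra)).
  pose proof (Cmod_ge_0 (G (Cconj (x, t)))).
  assert (H1 : Cmod (G (Cconj (x, t))) ^ 2 <= Cmod (G (x, t)) ^ 2) by (apply pow_incr; lra).
  rewrite !Cmod2_alt in H1. unfold Cconj in H1; simpl in H1 |- *. lra.
Qed.

(** * Hermite-Biehler functions: pencil, Wronskian, boundary derivative, sign comparison *)

Lemma hb_Cmod_le (H : C -> C) (H_HB : HB H) (z : C) : 0 <= Im z -> Cmod (H (Cconj z)) <= Cmod (H z).
Proof.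
  intros [Hz | Hz].
  - left. apply H_HB. exact Hz.
  - right. do 2 f_equal. destruct z; unfold Cconj; simpl in *. rewrite <- Hz, Ropp_0; reflexivity.
Qed.

Lemma hb_neq_0 (H : C -> C) (H_HB : HB H)
  (H_real : forall x : R, H (RtoC x) <> 0%C) (z : C) : 0 <= Im z -> H z <> 0%C.
Proof.
  intros [Hz | Hz].
  - apply Cmod_gt_0. eapply Rle_lt_trans; [apply Cmod_ge_0 | apply H_HB; exact Hz].
  - destruct z as [x y]; simpl in Hz; subst y. apply H_real.
Qed.

(** [K] enters only as an a priori bound for two uses of the Phragmén-Lindelöf principle; the sharp
    constants [M] and 1 come from the real line. *)
Lemma hb_pencil (H f : C -> C) (K M M' : R) :
  HB H -> (forall x : R, H (RtoC x) <> 0%C) ->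
  entire f ->
  (forall z, 0 < Im z -> Cmod (f z) <= K * Cmod (H z)) ->
  (forall z, 0 < Im z -> Cmod (f (Cconj z)) <= K * Cmod (H z)) ->
  (forall x : R, Cmod (f (RtoC x)) <= M * Cmod (H (RtoC x))) ->
  0 <= M < M' ->
  forall z, 0 < Im z ->
    Cmod (RtoC M' * H (Cconj z) - f (Cconj z)) <= Cmod (RtoC M' * H z - f z).
Proof.
  intros H_HB H_real Hf HK HK' HM HMM'.
  assert (HE : entire H) by apply H_HB.
  assert (Hpos : forall z, 0 <= Im z -> 0 < Cmod (H z))
    by (intros z Hz; apply Cmod_gt_0, (hb_neq_0 H H_HB H_real), Hz).
  assert (HfM : forall z, 0 <= Im z -> Cmod (f z) <= M * Cmod (H z)).
  { intros z Hz.
    assert (Hq : Cmod (f z / H z) <= M).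
    { apply (phragmen_lindelof (fun w => f w / H w)%C K M); auto.
      - lra.
      - intros w Hw. apply C_differentiable_div; auto. apply (hb_neq_0 H H_HB H_real), Hw.
      - intros w Hw. rewrite Cmod_div by (apply (hb_neq_0 H H_HB H_real); lra).
        apply Rle_div_l; [apply Hpos; lra | apply HK, Hw].
      - intros x. rewrite Cmod_div by apply H_real.
        apply Rle_div_l; [apply Cmod_gt_0, H_real | apply HM]. }
    rewrite Cmod_div in Hq by (apply (hb_neq_0 H H_HB H_real), Hz).
    apply Rle_div_l in Hq; [exact Hq | apply Hpos, Hz]. }
  set (G := fun z => (RtoC M' * H z - f z)%C).
  assert (HG : forall z, 0 <= Im z -> (M' - M) * Cmod (H z) <= Cmod (G z)).
  { intros z Hz. pose proof (Cmod_le_add_dist (RtoC M' * H z) (f z)) as H1.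
    rewrite Cmod_mult, Cmod_R, Rabs_pos_eq in H1 by lra. fold (G z) in H1.
    specialize (HfM z Hz). lra. }
  assert (HG0 : forall z, 0 <= Im z -> 0 < Cmod (G z)).
  { intros z Hz. specialize (HG z Hz). specialize (Hpos z Hz).
    assert (0 < (M' - M) * Cmod (H z)) by (apply Rmult_lt_0_compat; lra). lra. }
  assert (HGe : entire G).
  { intros z. apply C_differentiable_minus; [|apply Hf].
    apply C_differentiable_mult; [apply C_differentiable_const | apply HE]. }
  intros z Hz. change (Cmod (G (Cconj z)) <= Cmod (G z)).
  assert (Hq : Cmod (sharp G z / G z) <= 1).
  (* The a priori constant: the numerator is at most [(M' + K) |H w|], since [|H|] is no larger at
     the conjugate point, and the denominator is at least [(M' - M) |H w|]. *)
  { apply (phragmen_lindelof (fun w => sharp G w / G w)%C ((M' + K) / (M' - M)) 1); try lra.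
    - intros w Hw. apply C_differentiable_div; auto.
      + apply C_differentiable_sharp, HGe.
      + apply Cmod_gt_0, HG0, Hw.
    - intros w Hw. rewrite Cmod_div by (apply Cmod_gt_0, HG0; lra).
      apply Rle_div_l; [apply HG0; lra|].
      unfold sharp at 1. rewrite Cmod_conj.
      assert (H1 : Cmod (G (Cconj w)) <= (M' + K) * Cmod (H w)).
      { unfold G. eapply Rle_trans; [apply Cmod_triangle|].
        rewrite Cmod_opp, Cmod_mult, Cmod_R, Rabs_pos_eq by lra.
        pose proof (hb_Cmod_le H H_HB w ltac:(lra)). specialize (HK' w Hw). nra. }
      specialize (HG w ltac:(lra)).
      assert (0 <= (M' + K)).
      { specialize (Hpos w ltac:(lra)). pose proof (Cmod_ge_0 (G (Cconj w))). nra. }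
      assert (0 <= (M' + K) / (M' - M)) by (apply Rdiv_le_0_compat; lra).
      apply Rle_trans with ((M' + K) / (M' - M) * ((M' - M) * Cmod (H w))).
      + replace ((M' + K) / (M' - M) * ((M' - M) * Cmod (H w))) with ((M' + K) * Cmod (H w))
          by (field; lra). exact H1.
      + apply Rmult_le_compat_l; assumption.
    - intros x. rewrite Cmod_div by (apply Cmod_gt_0, HG0; simpl; lra).
      unfold sharp. rewrite Cmod_conj.
      replace (Cconj (RtoC x)) with (RtoC x)
        by (unfold Cconj, RtoC; simpl; f_equal; ring).
      right. field. apply Rgt_not_eq, HG0; simpl; lra. }
  rewrite Cmod_div in Hq by (apply Cmod_gt_0, HG0; lra).
  apply Rle_div_l in Hq; [|apply HG0; lra].
  unfold sharp in Hq. rewrite Cmod_conj in Hq. lra.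
Qed.

(** For [(M + eps) H - f] both sides of the Wronskian inequality carry the factor [M + eps], because
    [f] and its derivative are real on the line. Dividing by it before [eps] tends to 0 covers
    [M = 0] as well. *)
Lemma hb_wronskian (H f : C -> C) (K M x : R) (h phi : C) :
  HB H -> (forall x : R, H (RtoC x) <> 0%C) ->
  real_entire f ->
  (forall z, 0 < Im z -> Cmod (f z) <= K * Cmod (H z)) ->
  (forall z, 0 < Im z -> Cmod (f (Cconj z)) <= K * Cmod (H z)) ->
  (forall x : R, Cmod (f (RtoC x)) <= M * Cmod (H (RtoC x))) ->
  0 <= M ->
  is_C_derive H (RtoC x) h -> is_C_derive f (RtoC x) phi ->
  (M * Re (H (RtoC x)) - Re (f (RtoC x))) * Im h <=
  (M * Re h - Re phi) * Im (H (RtoC x)).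
Proof.
  intros H_HB H_real [Hf Hfr] HK HK' HM HM0 Hh Hphi.
  assert (Himphi : Im phi = 0).
  { destruct (is_C_derive_horizontal f x phi Hphi) as [_ D].
    transitivity (Derive (fun t => Im (f (RtoC t))) x);
      [symmetry; apply is_derive_unique, D|].
    rewrite (Derive_ext (fun t => Im (f (RtoC t))) (fun _ => 0) x Hfr). apply Derive_const. }
  set (A := Re (H (RtoC x))). set (B := Im (H (RtoC x))). set (F := Re (f (RtoC x))).
  (* Dominates the coefficient of [eps] in the perturbed inequality; the [+ 1] makes it positive. *)
  set (c := Rabs (A * Im h) + Rabs (Re h * B) + 1).
  apply (le_of_le_add_small _ _ c).
  { unfold c. pose proof (Rabs_pos (A * Im h)); pose proof (Rabs_pos (Re h * B)); lra. }
  intros eps Heps.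
  assert (W := wronskian_of_hb (fun z => RtoC (M + eps) * H z - f z)%C x
    (RtoC (M + eps) * h - phi)%C
    (hb_pencil H f K M (M + eps) H_HB H_real Hf HK HK' HM ltac:(lra))).
  assert (D : is_C_derive (fun z => RtoC (M + eps) * H z - f z)%C (RtoC x)
    (RtoC (M + eps) * h - phi)%C).
  { apply is_C_derive_minus; [|exact Hphi].
    assert (D1 := is_C_derive_mult (fun _ => RtoC (M + eps)) H (RtoC x) 0 h
      (@is_derive_const C_AbsRing C_NormedModule (RtoC (M + eps)) (RtoC x)) Hh).
    cbv beta in D1.
    replace (0 * H (RtoC x) + RtoC (M + eps) * h)%C with (RtoC (M + eps) * h)%C in D1 by ring.
    exact D1. }
  specialize (W D). cbv beta in W.
  rewrite !Re_minus, !Im_minus, !re_scal_l, !im_scal_l, (Hfr x), Himphi in W.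
  fold A B F in W.
  assert (W' : ((M + eps) * A - F) * Im h <= ((M + eps) * Re h - Re phi) * B).
  { apply (Rmult_le_reg_l (M + eps)); [lra|]. lra. }
  pose proof (Rle_abs (- (A * Im h))) as R1. rewrite Rabs_Ropp in R1.
  pose proof (Rle_abs (Re h * B)) as R2. unfold c. nra.
Qed.

(* Hopf's boundary lemma at [xi]: with [p = xi + i] and [Theta = sharp H / H], which is
   [1] at [xi], the function [Theta - i delta / (z - p)] is at most [1 + delta] in modulus
   on the annulus [1/2 <= |z - p| <= 1]. *)
Lemma hb_boundary_derivative (H : C -> C) (xi : R) (l : C) :
  HB H -> (forall x : R, H (RtoC x) <> 0%C) ->
  0 < Re (H (RtoC xi)) -> Im (H (RtoC xi)) = 0 -> is_C_derive H (RtoC xi) l -> Im l < 0.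
Proof.
  intros H_HB H_real Hs Him Hl.
  assert (HE : entire H) by apply H_HB.
  set (s := Re (H (RtoC xi))) in *.
  assert (HH : H (RtoC xi) = RtoC s).
  { unfold s. destruct (H (RtoC xi)) as [u v]; simpl in *; rewrite Him; reflexivity. }
  set (p := (xi, 1) : C).
  set (T := fun z => (sharp H z / H z)%C).
  assert (HIm : forall z, Cmod (z - p) <= 1 -> 0 <= Im z).
  { intros z Hz. pose proof (Im_dist_bounds z p) as Hb. simpl in Hb. lra. }
  assert (HT : forall z, 0 <= Im z -> C_differentiable T z).
  { intros z Hz. apply C_differentiable_div; [apply C_differentiable_sharp, HE | apply HE |].
    apply (hb_neq_0 H H_HB H_real), Hz. }
  assert (HTm : forall z, 0 <= Im z -> Cmod (T z) <= 1).
  { intros z Hz. unfold T. rewrite Cmod_div by (apply (hb_neq_0 H H_HB H_real), Hz).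
    apply Rle_div_l; [apply Cmod_gt_0, (hb_neq_0 H H_HB H_real), Hz|].
    unfold sharp; rewrite Cmod_conj, Rmult_1_l. apply (hb_Cmod_le H H_HB), Hz. }
  assert (HTs : forall z, 0 < Im z -> Cmod (T z) < 1).
  { intros z Hz. unfold T. rewrite Cmod_div by (apply (hb_neq_0 H H_HB H_real); lra).
    apply Rlt_div_l; [apply Cmod_gt_0, (hb_neq_0 H H_HB H_real); lra|].
    unfold sharp; rewrite Cmod_conj, Rmult_1_l. apply H_HB, Hz. }
  assert (Hpmod : forall z, Cmod z <= Cmod p + Cmod (z - p)) by (intros z; apply Cmod_le_add_dist).
  assert (Hrho : forall w z, Cmod (w - p) - Cmod (w - z) <= Cmod (z - p) <=
    Cmod (w - p) + Cmod (w - z)).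
  { intros w z. pose proof (Cmod_le_add_dist (w - p) (z - p)) as H1.
    pose proof (Cmod_le_add_dist (z - p) (w - p)) as H2.
    replace (w - p - (z - p))%C with (w - z)%C in H1 by ring.
    replace (z - p - (w - p))%C with (z - w)%C in H2 by ring.
    rewrite (Cmod_minus_sym z w) in H2. lra. }
  (* Compactness of the inner circle turns the pointwise inequality [|T| < 1] into a uniform gap
     [delta]. *)
  destruct (compact_max (fun z => Cmod (z - p) = 1 / 2) (fun z => Cmod (T z)) (Cmod p + 1 / 2))
    as [z0 [Kz0 Hz0]].
  { exists (p + 1 / 2)%C. replace (p + 1 / 2 - p)%C with (RtoC (1 / 2)).
    - rewrite Cmod_R. apply Rabs_pos_eq; lra.
    - rewrite RtoC_div by lra. ring. }
  { intros z Hz. specialize (Hpmod z). lra. }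
  { intros z Hz. exists (Rabs (Cmod (z - p) - 1 / 2)).
    split; [apply Rabs_pos_lt; lra|]. intros w Hw Hw'.
    specialize (Hrho w z). rewrite Hw' in Hrho.
    assert (Rabs (Cmod (z - p) - 1 / 2) <= Cmod (w - z)); [|lra].
    apply Rabs_le_between; lra. }
  { intros z Hz eps He. destruct (HT z (HIm z ltac:(lra))) as [k Hk].
    destruct (is_C_derive_continuous T z k Hk eps He) as [d [Hd Hd1]].
    exists d; split; [exact Hd|]. intros w Hw. specialize (Hd1 w Hw).
    pose proof (Cmod_le_add_dist (T w) (T z)). lra. }
  set (delta := 1 - Cmod (T z0)).
  assert (Hdelta : 0 < delta).
  { assert (0 < Im z0).
    { pose proof (Im_dist_bounds z0 p) as Hb. simpl in Hb. lra. }
    unfold delta. specialize (HTs z0 H0). lra. }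
  assert (Hd0 : forall z, 1 / 2 <= Cmod (z - p) -> (z - p)%C <> 0%C)
    by (intros z Hz; apply Cmod_gt_0; lra).
  set (g := fun z => (T z - Ci * RtoC delta / (z - p))%C).
  assert (Hg : forall z, 1 / 2 <= Cmod (z - p) <= 1 -> Cmod (g z) <= 1 + delta).
  { apply (maximum_modulus (fun z => 1 / 2 <= Cmod (z - p) <= 1)
      (fun z => Cmod (z - p) = 1 / 2 \/ Cmod (z - p) = 1) g (Cmod p + 1)).
    - lra.
    - intros z Hz. specialize (Hpmod z). lra.
    - intros z Hz. destruct (Rlt_dec (Cmod (z - p)) (1 / 2)) as [C1 | C1].
      + exists (1 / 2 - Cmod (z - p)). split; [lra|]. intros w Hw Hw'.
        specialize (Hrho w z). lra.
      + exists (Cmod (z - p) - 1). split; [lra|]. intros w Hw Hw'.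
        specialize (Hrho w z). lra.
    - intros z Hz.
      destruct (Req_dec (Cmod (z - p)) (1 / 2)) as [C1 | C1]; [tauto|].
      destruct (Req_dec (Cmod (z - p)) 1) as [C2 | C2]; [tauto|]. right.
      exists (Rmin (Cmod (z - p) - 1 / 2) (1 - Cmod (z - p))).
      split; [apply Rmin_pos; lra|]. intros w Hw.
      pose proof (Rmin_l (Cmod (z - p) - 1 / 2) (1 - Cmod (z - p))).
      pose proof (Rmin_r (Cmod (z - p) - 1 / 2) (1 - Cmod (z - p))).
      specialize (Hrho w z). lra.
    - intros z Hz. apply C_differentiable_minus; [apply HT, HIm; lra|].
      apply C_differentiable_div; [apply C_differentiable_const | | apply Hd0; lra].
      apply C_differentiable_minus; [apply C_differentiable_id | apply C_differentiable_const].
    (* The bound is [(1 - delta) + 2 delta] on the inner circle and [1 + delta] on the outer one. *)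
    - intros z Hz HS. unfold g. eapply Rle_trans; [apply Cmod_triangle|].
      rewrite Cmod_opp, Cmod_div, Cmod_mult, Cmod_Ci, Cmod_R, Rabs_pos_eq
        by (try apply Hd0; lra).
      destruct HS as [HS | HS]; rewrite HS.
      + specialize (Hz0 z HS). unfold delta in *. lra.
      + specialize (HTm z (HIm z ltac:(lra))). lra. }
  (* On the radius from [p] down to [xi] the added term equals [delta / (1 - y)], which is at least
     [delta * (1 + y)]. *)
  assert (HRe : forall y, 0 < y < 1 / 2 -> Re (T (xi, y)) <= 1 - delta * y).
  { intros y Hy.
    assert (Ep : ((xi, y) - p)%C = (- (Ci * RtoC (1 - y)))%C).
    { unfold p, Ci, RtoC, Cminus, Cplus, Copp, Cmult; simpl. f_equal; ring. }
    assert (Hr : 1 / 2 <= Cmod ((xi, y) - p) <= 1).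
    { rewrite Ep, Cmod_opp, Cmod_mult, Cmod_Ci, Cmod_R, Rabs_pos_eq by lra. lra. }
    specialize (Hg _ Hr). unfold g in Hg. rewrite Ep in Hg.
    assert (Hy0 : RtoC (1 - y) <> 0%C) by (intros E; apply RtoC_inj in E; lra).
    assert (HCi : Ci <> 0%C) by (intros E; apply (f_equal Im) in E; simpl in E; lra).
    replace (Ci * RtoC delta / - (Ci * RtoC (1 - y)))%C with (- RtoC (delta / (1 - y)))%C in Hg
      by (rewrite RtoC_div by lra; field; auto).
    pose proof (re_le_Cmod (T (xi, y) - - RtoC (delta / (1 - y)))) as H1.
    apply Rabs_le_between in H1. rewrite Re_minus, re_opp, re_RtoC in H1.
    assert (delta * (1 + y) <= delta / (1 - y)).
    { apply (Rle_div_r (delta * (1 + y)) delta (1 - y)); [lra|].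
      assert (0 <= delta * (y * y)) by (apply Rmult_le_pos; [lra | apply Rle_0_sqr]). lra. }
    lra. }
  assert (HTd := is_C_derive_mult (sharp H) (fun w => / H w)%C (RtoC xi) _ _
    (is_C_derive_sharp H (RtoC xi) l
      ltac:(replace (Cconj (RtoC xi)) with (RtoC xi)
              by (unfold Cconj, RtoC; simpl; f_equal; ring); exact Hl))
    (is_C_derive_inv H (RtoC xi) l Hl (H_real xi))).
  assert (Hsh : sharp H (RtoC xi) = RtoC s).
  { unfold sharp. replace (Cconj (RtoC xi)) with (RtoC xi)
      by (unfold Cconj, RtoC; simpl; f_equal; ring).
    rewrite HH. unfold Cconj, RtoC; simpl; f_equal; ring. }
  cbv beta in HTd. rewrite Hsh, HH in HTd.
  assert (Hs0 : RtoC s <> 0%C) by (intros E; apply RtoC_inj in E; lra).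
  (* Thus [T] has derivative [- 2 i Im l / s] at [xi], and [Re T] has vertical derivative
     [2 Im l / s], to be compared with the slope [- delta]. *)
  replace (Cconj l * / RtoC s + RtoC s * (l * (- (1) / (RtoC s * RtoC s))))%C
    with (RtoC (/ s) * (Cconj l - l))%C in HTd
    by (rewrite RtoC_inv by lra; field; auto).
  destruct (is_C_derive_vertical T xi 0 _ HTd) as [D _].
  rewrite im_scal_l, Im_minus, im_conj in D.
  assert (HT1 : Re (T (xi, 0)) = 1).
  { change (xi, 0) with (RtoC xi). unfold T. rewrite Hsh, HH.
    replace (RtoC s / RtoC s)%C with (RtoC 1) by (field; auto). apply re_RtoC. }
  assert (0 <= - delta - (- (/ s * (- Im l - Im l)))).
  { apply (right_derivative_nonneg (fun y => (1 - delta * y) - Re (T (xi, y))) 0 _ (1 / 2)).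
    - apply (is_derive_minus (fun y => 1 - delta * y)); [|exact D].
      auto_derive; auto; ring.
    - lra.
    - intros y Hy. specialize (HRe y Hy). rewrite HT1. lra. }
  assert (0 < / s) by (apply Rinv_0_lt_compat; exact Hs).
  apply Rnot_le_lt; intros Hle.
  assert (0 <= / s * Im l) by (apply Rmult_le_pos; lra). lra.
Qed.

(* If [N > 0] at a point right of [xi], monotonicity of [N / B] there yields [c > 0] with
   [N + c B >= 0] near [xi], although [N + c B] has derivative [c B' < 0] at [xi]. *)
Lemma comparison_right (N B N' B' : R -> R) (xi b : R) :
  (forall x, is_derive N x (N' x)) -> (forall x, is_derive B x (B' x)) ->
  (forall x, N x * B' x <= N' x * B x) ->
  N xi = 0 -> N' xi = 0 -> B xi = 0 -> B' xi < 0 ->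
  (forall t, xi < t < b -> B t <> 0) ->
  forall x, xi <= x <= b -> N x <= 0.
Proof.
  intros DN DB W N0 N0' B0 B0' Bne.
  (* [B' xi < 0] makes [B] negative somewhere just right of [xi]; a change of sign before [b] would
     produce a zero. *)
  assert (Bneg : forall t, xi < t < b -> B t < 0).
  { intros t Ht. apply Rnot_le_lt; intros [Hle | Hle]; [|apply (Bne t Ht); auto].
    assert (Hu : exists u, xi < u < t /\ B u < 0).
    { apply NNPP; intros Hno. assert (0 <= B' xi); [|lra].
      apply (right_derivative_nonneg B xi (B' xi) t (DB xi)); [lra|].
      intros u Hu. rewrite B0. apply Rnot_lt_le; intros Hlt. apply Hno; exists u; auto. }
    destruct Hu as [u [Hu Hlt]].
    destruct (IVT B u t) as [z [Hz Bz]]; auto; try lra.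
    - intros y. apply derivable_continuous_pt. exists (B' y). apply is_derive_Reals, DB.
    - apply (Bne z); [lra | exact Bz]. }
  assert (Hin : forall x, xi < x < b -> N x <= 0).
  { intros x Hx. apply Rnot_lt_le; intros Hlt.
    pose proof (Bneg x Hx) as HBx.
    set (c := - (N x / B x)).
    assert (Hc : 0 < c).
    { unfold c. replace (- (N x / B x)) with (N x / - B x) by (field; lra).
      apply Rdiv_lt_0_compat; lra. }
    assert (0 <= N' xi + c * B' xi); [|rewrite N0' in *; nra].
    apply (right_derivative_nonneg (fun t => N t + c * B t) xi _ x).
    - apply (is_derive_plus N (fun t => c * B t)); [apply DN|].
      apply is_derive_scal, DB.
    - lra.
    - intros t Ht. rewrite N0, B0. pose proof (Bneg t ltac:(lra)) as HBt.
      destruct (MVT_gen (fun u => N u / B u) t x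
        (fun u => (N' u * B u - N u * B' u) / (B u) ^ 2)) as [u [Hu E]].
      + rewrite Rmin_left, Rmax_right by lra. intros u Hu.
        apply is_derive_div; auto. apply Rlt_not_eq, Bneg; lra.
      + rewrite Rmin_left, Rmax_right by lra. intros u Hu.
        apply derivable_continuous_pt. eexists. apply is_derive_Reals.
        apply is_derive_div; auto. apply Rlt_not_eq, Bneg; lra.
      + rewrite Rmin_left, Rmax_right in Hu by lra.
        assert (0 <= (N' u * B u - N u * B' u) / (B u) ^ 2).
        { apply Rdiv_le_0_compat; [specialize (W u); lra|].
          pose proof (Bneg u ltac:(lra)). nra. }
        assert (Hq : N t / B t <= - c) by (unfold c; nra).
        assert (N t / B t * B t >= - c * B t) by nra.
        replace (N t / B t * B t) with (N t) in * by (field; lra). lra. }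
  intros x Hx. destruct (Req_dec x xi) as [-> | Hne]; [lra|].
  destruct (Req_dec x b) as [-> | Hne']; [|apply Hin; lra].
  (* [B] may vanish at [b], so this endpoint is reached by continuity of [N] instead of through the
     quotient. *)
  apply Rnot_lt_le; intros Hlt.
  assert (Hc : continuity_pt N b).
  { apply derivable_continuous_pt. exists (N' b). apply is_derive_Reals, DN. }
  destruct (Hc (N b) Hlt) as [d [Hd H]].
  set (e := Rmin d (b - xi) / 2).
  assert (He : 0 < e /\ e < d /\ e < b - xi).
  { pose proof (Rmin_l d (b - xi)); pose proof (Rmin_r d (b - xi)).
    assert (0 < Rmin d (b - xi)) by (apply Rmin_pos; lra). unfold e; lra. }
  specialize (H (b - e)). simpl in H. unfold R_dist, D_x, no_cond in H.
  assert (Hb : Rabs (N (b - e) - N b) < N b).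
  { apply H. split; [split; [auto | lra]|].
    replace (b - e - b) with (- e) by ring. rewrite Rabs_Ropp, Rabs_pos_eq; lra. }
  apply Rabs_def2 in Hb. specialize (Hin (b - e) ltac:(lra)). lra.
Qed.

(** Reflection in 0 reduces this to the right-hand case. [B] is negated as well, so that its
    derivative at [- xi] is still [B' xi < 0]; the two sign changes cancel in the Wronskian
    inequality. *)
Lemma comparison_left (N B N' B' : R -> R) (xi a : R) :
  (forall x, is_derive N x (N' x)) -> (forall x, is_derive B x (B' x)) ->
  (forall x, N x * B' x <= N' x * B x) ->
  N xi = 0 -> N' xi = 0 -> B xi = 0 -> B' xi < 0 ->
  (forall t, a < t < xi -> B t <> 0) ->
  forall x, a <= x <= xi -> N x <= 0.
Proof.
  intros DN DB W N0 N0' B0 B0' Bne x Hx.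
  rewrite <- (Ropp_involutive x).
  apply (comparison_right (fun t => N (- t)) (fun t => - B (- t)) (fun t => - N' (- t))
    (fun t => B' (- t)) (- xi) (- a)); try (rewrite Ropp_involutive); try lra.
  - intros t. apply is_derive_reflect, DN.
  - intros t. rewrite <- (Ropp_involutive (B' (- t))).
    apply (is_derive_opp (fun t => B (- t))). apply is_derive_reflect, DB.
  - intros t. specialize (W (- t)). lra.
  - intros t Ht. specialize (Bne (- t) ltac:(lra)). lra.
Qed.

(** * Boundary values and the supremum norm *)

(** Continuity along the vertical through [x]. This carries the bound that [Hinf] gives in the open
    half-plane to the line on which [supnorm] is taken. *)
Lemma Cmod_le_boundary (h : C -> C) (K x : R) :
  C_differentiable h (RtoC x) -> (forall z, 0 < Im z -> Cmod (h z) <= K) ->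
  Cmod (h (RtoC x)) <= K.
Proof.
  intros [l Hl] HK. apply (le_of_le_add_small _ _ 1); [lra|]. intros eps Heps.
  destruct (is_C_derive_continuous h _ _ Hl eps (proj1 Heps)) as [d [Hd H]].
  assert (Hw : Cmod (Cminus (x, d / 2) (RtoC x)) < d).
  { replace (Cminus (x, d / 2) (RtoC x)) with (Ci * RtoC (d / 2))%C
      by (unfold Ci, RtoC, Cminus, Cplus, Copp, Cmult; simpl; f_equal; ring).
    rewrite Cmod_mult, Cmod_Ci, Cmod_R, Rabs_pos_eq; lra. }
  specialize (H _ Hw). rewrite Cmod_minus_sym in H.
  pose proof (Cmod_le_add_dist (h (RtoC x)) (h (x, d / 2))).
  specialize (HK (x, d / 2) ltac:(simpl; lra)). lra.
Qed.

(** [real] sends an infinite least upper bound to 0; the bound [K] excludes that value, so [supnorm]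
    is a genuine supremum. *)
Lemma le_supnorm (f E : C -> C) (K : R) :
  (forall x : R, Cmod (f (RtoC x) / E (RtoC x)) <= K) ->
  forall x : R, Cmod (f (RtoC x) / E (RtoC x)) <= supnorm f E.
Proof.
  intros HK x. unfold supnorm.
  destruct (Lub_Rbar_correct (fun y : R => exists x : R, y = Cmod (f (RtoC x) / E (RtoC x))%C))
    as [Hub Hlub].
  specialize (Hub _ (ex_intro _ x eq_refl)).
  specialize (Hlub (Finite K)).
  destruct (Lub_Rbar _) as [r | |]; simpl in *; auto; try contradiction.
  exfalso; apply Hlub. intros y [t ->]. simpl. apply HK.
Qed.

Lemma Cmod_cis (a : R) : Cmod (cis a) = 1.
Proof.
  unfold Cmod, cis; simpl. pose proof (sin2_cos2 a) as H. unfold Rsqr in H.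
  replace (cos a * (cos a * 1) + sin a * (sin a * 1)) with 1 by lra. apply sqrt_1.
Qed.

Theorem theorem1 (E f : C -> C) (xi alpha bl br : R) :
  HB E ->
  (forall x : R, E (RtoC x) <> 0%C) ->
  Hinf E f ->
  real_entire f ->
  f (RtoC xi) = RtoC (Cmod (E (RtoC xi)) * supnorm f E) ->
  E (RtoC xi) = (cis (- alpha) * RtoC (Cmod (E (RtoC xi))))%C ->
  bl < xi < br ->
  B_fun alpha E (RtoC bl) = 0%C ->
  B_fun alpha E (RtoC br) = 0%C ->
  (forall t : R, bl < t < xi -> B_fun alpha E (RtoC t) <> 0%C) ->
  (forall t : R, xi < t < br -> B_fun alpha E (RtoC t) <> 0%C) ->
  forall x : R, bl <= x <= br ->
    Re (f (RtoC x)) >= supnorm f E * Re (A_fun alpha E (RtoC x)).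
Proof.
  intros HE E0 [Hfe [[_ [K1 HK1]] [_ [K2 HK2]]]] Hf Hmax Harg Hxi _ _ HBl HBr.
  set (M := supnorm f E) in *.
  set (H := E_rot alpha E).
  assert (Hmod : forall z, Cmod (H z) = Cmod (E z)).
  { intros z. unfold H, E_rot. rewrite Cmod_mult, Cmod_cis. ring. }
  assert (Hent : entire H).
  { intros z. apply C_differentiable_mult; [apply C_differentiable_const | apply HE]. }
  assert (HHB : HB H).
  { split; [exact Hent|]. intros z Hz. rewrite !Hmod. apply HE, Hz. }
  assert (H0 : forall x : R, H (RtoC x) <> 0%C).
  { intros x. apply Cmod_gt_0. rewrite Hmod. apply Cmod_gt_0, E0. }
  assert (Epos : forall z, 0 < Im z -> 0 < Cmod (E z)).
  { intros z Hz. eapply Rle_lt_trans; [apply Cmod_ge_0 | apply HE, Hz]. }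
  set (K := Rmax K1 K2).
  assert (HK : forall z, 0 < Im z -> Cmod (f z) <= K * Cmod (H z)).
  { intros z Hz. specialize (HK1 z Hz). specialize (Epos z Hz).
    rewrite Cmod_div in HK1 by (apply Cmod_gt_0, Epos). apply Rle_div_l in HK1; [|exact Epos].
    rewrite Hmod. pose proof (Rmax_l K1 K2). fold K in H1. nra. }
  assert (HK' : forall z, 0 < Im z -> Cmod (f (Cconj z)) <= K * Cmod (H z)).
  { intros z Hz. specialize (HK2 z Hz). specialize (Epos z Hz).
    rewrite Cmod_div in HK2 by (apply Cmod_gt_0, Epos). apply Rle_div_l in HK2; [|exact Epos].
    unfold sharp in HK2. rewrite Cmod_conj in HK2.
    rewrite Hmod. pose proof (Rmax_r K1 K2). fold K in H1. nra. }
  assert (Hsup : forall x : R, Cmod (f (RtoC x) / E (RtoC x)) <= M).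
  { apply (le_supnorm f E K1). intros x.
    apply (Cmod_le_boundary (fun z => f z / E z)%C K1 x); [|exact HK1].
    apply C_differentiable_div; [apply Hfe | apply HE | apply E0]. }
  assert (HM0 : 0 <= M) by (eapply Rle_trans; [apply Cmod_ge_0 | apply (Hsup 0)]).
  assert (HM : forall x : R, Cmod (f (RtoC x)) <= M * Cmod (H (RtoC x))).
  { intros x. specialize (Hsup x). rewrite Cmod_div in Hsup by apply E0.
    rewrite Hmod. apply Rle_div_l in Hsup; [exact Hsup | apply Cmod_gt_0, E0]. }
  assert (HA : forall x : R, Re (A_fun alpha E (RtoC x)) = Re (H (RtoC x))).
  { intros x. unfold A_fun, sharp. fold H.
    replace (Cconj (RtoC x)) with (RtoC x) by (unfold Cconj, RtoC; simpl; f_equal; ring).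
    rewrite <- re_alt. apply re_RtoC. }
  assert (HB' : forall x : R, B_fun alpha E (RtoC x) = RtoC (Im (H (RtoC x)))).
  { intros x. unfold B_fun, sharp. fold H.
    replace (Cconj (RtoC x)) with (RtoC x) by (unfold Cconj, RtoC; simpl; f_equal; ring).
    rewrite <- im_alt. reflexivity. }
  set (s := Cmod (E (RtoC xi))).
  assert (Hs : 0 < s) by (apply Cmod_gt_0, E0).
  (* The choice of [alpha] makes [H] positive at [xi]: there [A = |E|] and [B = 0]. *)
  assert (Hxi1 : H (RtoC xi) = RtoC s).
  { unfold H, E_rot. rewrite Harg. fold s. rewrite Cmult_assoc.
    replace (cis alpha * cis (- alpha))%C with (RtoC 1); [ring|].
    unfold cis, Cmult, RtoC; simpl. rewrite cos_neg, sin_neg.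
    pose proof (sin2_cos2 alpha) as Hsc. unfold Rsqr in Hsc. f_equal; lra. }
  set (dH := fun x : R => C_derive H (RtoC x)).
  set (df := fun x : R => C_derive f (RtoC x)).
  (* [RtoC 0] fills a complex argument of [C_derive_correct] that the goal does not determine. *)
  assert (DH : forall x : R, is_C_derive H (RtoC x) (dH x))
    by (intros x; apply C_derive_correct; [exact (RtoC 0) | apply Hent]).
  assert (Df : forall x : R, is_C_derive f (RtoC x) (df x))
    by (intros x; apply C_derive_correct; [exact (RtoC 0) | apply Hfe]).
  set (N := fun x : R => M * Re (H (RtoC x)) - Re (f (RtoC x))).
  set (N' := fun x : R => M * Re (dH x) - Re (df x)).
  assert (DN : forall x, is_derive N x (N' x)).
  { intros x. apply (is_derive_minus (fun x => M * Re (H (RtoC x)))).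
    - apply is_derive_scal, is_C_derive_horizontal, DH.
    - apply is_C_derive_horizontal, Df. }
  assert (DB : forall x, is_derive (fun t => Im (H (RtoC t))) x (Im (dH x)))
    by (intros x; apply is_C_derive_horizontal, DH).
  assert (W : forall x, N x * Im (dH x) <= N' x * Im (H (RtoC x))).
  { intros x. apply (hb_wronskian H f K M x (dH x) (df x)); auto. }
  assert (N0 : N xi = 0).
  { unfold N. rewrite Hxi1, Hmax. fold s. rewrite !re_RtoC. ring. }
  assert (B0 : Im (H (RtoC xi)) = 0) by (rewrite Hxi1; reflexivity).
  assert (B1 : Im (dH xi) < 0).
  { apply (hb_boundary_derivative H xi); auto. rewrite Hxi1, re_RtoC. exact Hs. }
  (* [f <= M |H| <= M (|H|^2 / s + s) / 2] with equality at [xi]. *)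
  assert (N1 : N' xi = 0).
  { set (psi := fun t => M / (2 * s) * (Re (H (RtoC t)) ^ 2 + Im (H (RtoC t)) ^ 2) -
      Re (f (RtoC t))).
    destruct (is_C_derive_horizontal H xi _ (DH xi)) as [D1 D2].
    destruct (is_C_derive_horizontal f xi _ (Df xi)) as [D3 _].
    assert (D := is_derive_sqr_sum _ _ _ _ _ D1 D2).
    cbv beta in D. rewrite Hxi1, re_RtoC in D.
    replace (N' xi) with (M / (2 * s) * (2 * (s * Re (dH xi) + Im (RtoC s) * Im (dH xi)))
      - Re (df xi)) by (unfold N'; simpl; field; lra).
    apply (minimum_derivative_zero psi xi).
    - apply (is_derive_minus
        (fun t => M / (2 * s) * (Re (H (RtoC t)) ^ 2 + Im (H (RtoC t)) ^ 2))); [|exact D3].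
      apply is_derive_scal, D.
    - intros t. unfold psi. rewrite Hxi1, Hmax. fold s. rewrite !re_RtoC, <- Cmod2_alt.
      (* Completing the square, [psi t >= M / (2 s) * (c - s)^2 - s M / 2], and [- s M / 2] is the
         value at [xi]. *)
      set (c := Cmod (H (RtoC t))).
      assert (Re (f (RtoC t)) <= M * c).
      { eapply Rle_trans; [apply Rle_abs|].
        eapply Rle_trans; [apply re_le_Cmod | apply HM]. }
      assert (0 <= M / (2 * s) * (c - s) ^ 2)
        by (apply Rmult_le_pos; [apply Rdiv_le_0_compat; lra | apply pow2_ge_0]).
      replace (M / (2 * s) * (c - s) ^ 2)
        with (M / (2 * s) * c ^ 2 - M * c + s * M / 2) in * by (field; lra).
      replace (M / (2 * s) * (s ^ 2 + Im (RtoC s) ^ 2)) with (s * M / 2)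
        by (simpl; field; lra).
      lra. }
  assert (HBne : forall t : R, B_fun alpha E (RtoC t) <> 0%C -> Im (H (RtoC t)) <> 0).
  { intros t Ht E1. apply Ht. rewrite HB', E1. reflexivity. }
  intros x Hx. rewrite HA.
  assert (N x <= 0); [|unfold N in *; lra].
  destruct (Rle_dec xi x).
  - apply (comparison_right N (fun t => Im (H (RtoC t))) N' (fun t => Im (dH t)) xi br); auto.
    lra.
  - apply (comparison_left N (fun t => Im (H (RtoC t))) N' (fun t => Im (dH t)) xi bl); auto.
    lra.
Qed.
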